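(* For every extended quiver $\widetilde{\mathcal{Q}}$, all the rational functions $x_k', x_k'',\ldots$, obtained recurrently by any series of consecutive admissible (allowed) mutations, are Laurent polynomials in the initial coordinates $\{x_1,\ldots,x_n,\xi_1,\ldots,\xi_m\}$ (with denominators equal to monomials in $x_1,\ldots,x_n$ only, since division by odd variables is not defined).
   Context: Setting: $x_1,\ldots,x_n$ are even (commuting) variables and $\xi_1,\ldots,\xi_m$ are odd variables, which commute with the even ones and anticommute with each other (so $\xi_i^2=0$). An extended quiver $\widetilde{\mathcal{Q}}$ with underlying quiver $\mathcal{Q}$ (a finite oriented graph with no loops and no $2$-cycles, whose $n$ vertices are labeled $x_1,\ldots,x_n$) is the oriented hypergraph obtained by adding $m$ colored (odd) vertices labeled $\xi_1,\ldots,\xi_m$ and, for every $1\le k\le n$, fixing two disjoint subsets $I_k,J_k\subset\{1,\ldots,m\}$ and adding $2$-paths $(\xi_i\to x_k\to\xi_j)$ with $i\in I_k$, $j\in J_k$, subject to Condition (C): every $\xi_i$, $i\in I_k$, is connected to every $\xi_j$, $j\in J_k$, by exactly the same number of $2$-paths through $x_k$. There are no arrows between odd vertices. Mutation $\mu_k$ at an even vertex $x_k$: (0) the underlying quiver mutates by the classical rules (for every path $x_i\to x_k\to x_j$ add an arrow $x_i\to x_j$; reverse all arrows at $x_k$; remove the $2$-cycles created); (1* ) for every $2$-path $(\xi_i\to x_k\to\xi_j)$ and every arrow $(x_k\to x_\ell)$, add a $2$-path $(\xi_i\to x_\ell\to\xi_j)$; (2* ) reverse all $2$-paths through $x_k$;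 (3* ) cancel pairwise $2$-paths $(\xi_i\to x_\ell\to\xi_j)$ and $(\xi_i\leftarrow x_\ell\leftarrow\xi_j)$ of opposite orientation. A mutation is allowed (admissible) if the resulting extended quiver again satisfies Condition (C). The mutation $\mu_k$ replaces $x_k$ by $x_k'$ (all other variables unchanged) via the exchange relation $$x_kx_k'=\prod_{x_k\to x_j}x_j+\Big(1+\sum_{\xi_i\to x_k\to\xi_j}\xi_i\xi_j\Big)\prod_{x_i\to x_k}x_i,$$ where products run over arrows of $\mathcal{Q}$ and the sum over $2$-paths through $x_k$ (with multiplicity). *)

(* Defs.v *)
From HB Require Import structures.
From mathcomp Require Import all_boot all_order all_algebra.
From mathcomp Require Import ring fraction mpoly.

Set Implicit Arguments.
Unset Strict Implicit.
Unset Printing Implicit Defensive.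

Import GRing.Theory.
Local Open Scope ring_scope.

(* The Grassmann algebra over R on xi_0, ..., xi_(m-1): f stands for          *)
(* \sum_A f A * xi_A, where xi_A is the product of the xi_i, i in A, taken in *)
(* increasing order.                                                          *)
Definition grassmann (R : comNzRingType) (m : nat) : Type :=
  {ffun {set 'I_m} -> R}.

Section GrassmannRing.
Variables (R : comNzRingType) (m : nat).
Local Notation G := (grassmann R m).
Implicit Types (A B C D : {set 'I_m}) (f g h : G).

HB.instance Definition _ := GRing.Zmodule.on G.

(* For disjoint B and C, xi_B * xi_C = (-1) ^+ gr_inv B C * xi_(B :|: C).     *)
Definition gr_inv B C : nat := (\sum_(b in B) \sum_(c in C) (c < b))%N.

Definition gr_coef f A : R := (f : {ffun {set 'I_m} -> R}) A.

Definition gr_mul f g : G :=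
  [ffun A : {set 'I_m} => \sum_(B : {set 'I_m} | B \subset A)
     (-1) ^+ gr_inv B (A :\: B) * (gr_coef f B * gr_coef g (A :\: B))].

Definition gr_const (a : R) : G := [ffun A : {set 'I_m} => a *+ (A == set0)].

Definition gr_xi (i : 'I_m) : G := [ffun A : {set 'I_m} => (A == [set i])%:R].

Lemma gr_inv0l C : gr_inv set0 C = 0%N.
Proof. by rewrite /gr_inv big_set0. Qed.

Lemma gr_inv0r B : gr_inv B set0 = 0%N.
Proof. by rewrite /gr_inv big1 // => b _; rewrite big_set0. Qed.

Lemma gr_invUl B C D : [disjoint B & C] ->
  gr_inv (B :|: C) D = (gr_inv B D + gr_inv C D)%N.
Proof.
move=> dBC; rewrite /gr_inv -bigU //=.
by apply: eq_bigl => b; rewrite !inE.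
Qed.

Lemma gr_invUr B C D : [disjoint C & D] ->
  gr_inv B (C :|: D) = (gr_inv B C + gr_inv B D)%N.
Proof.
move=> dCD; rewrite /gr_inv -big_split /=.
by apply: eq_bigr => b _; rewrite -bigU //=; apply: eq_bigl => c; rewrite !inE.
Qed.

Lemma gr_mulA : associative gr_mul.
Proof.
move=> f g h; apply/ffunP=> A; rewrite !ffunE.
under eq_bigr => B sBA.
  rewrite /gr_coef ffunE big_distrr big_distrr /=.
over.
under [RHS]eq_bigr => D sDA.
  rewrite {1}/gr_coef ffunE big_distrl big_distrr /=.
over.
rewrite [RHS](exchange_big_dep (fun B => B \subset A)) /=; last first.
  by move=> D B sDA sBD; apply: subset_trans sBD sDA.
apply: eq_bigr => B sBA.
rewrite [RHS](reindex_onto (fun C => B :|: C) (fun D => D :\: B)) /=; last first.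
  by move=> D /andP[_ sBD]; rewrite setDE setUIr setUCr setIT; apply/setUidPr.
have e : forall C, (C \subset A :\: B) =
    [&& B :|: C \subset A, B \subset B :|: C & (B :|: C) :\: B == C].
  move=> C; rewrite subsetD subUset sBA subsetUl /= setDUl setDv set0U.
  by congr (_ && _); apply/setDidPl/eqP.
apply: eq_big => C; first by rewrite e andbA.
rewrite subsetD => /andP[sCA dCB]; have dBC: [disjoint B & C] by rewrite disjoint_sym.
rewrite setDUl setDv set0U (setDidPl dCB) -setDDl.
set E := A :\: B :\: C.
have dCE : [disjoint C & E].
  by rewrite disjoint_sym disjoints_subset /E [_ :\: C]setDE subsetIr.
have -> : A :\: B = C :|: E.
  have /setIidPr {1}<- : C \subset A :\: B by rewrite subsetD sCA dCB.
  by rewrite setID.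
rewrite gr_invUr // gr_invUl // !exprD /gr_coef.
by ring.
Qed.

Lemma gr_mul1r : left_id (gr_const 1) gr_mul.
Proof.
move=> f; apply/ffunP=> A; rewrite ffunE (bigD1 set0) ?sub0set //=.
rewrite big1 => [|B /andP[_ /negPf B0]]; last first.
  by rewrite /gr_coef ffunE B0 mul0r mulr0.
by rewrite /gr_coef ffunE eqxx setD0 gr_inv0l expr0 !mul1r addr0.
Qed.

Lemma gr_mulr1 : right_id (gr_const 1) gr_mul.
Proof.
move=> f; apply/ffunP=> A; rewrite ffunE (bigD1 A) //=.
rewrite big1 => [|B /andP[sBA /negPf nBA]]; last first.
  by rewrite /gr_coef ffunE setD_eq0 -(negbK (A \subset B)) /= [A \subset B]negbTE
    ?mulr0 //; apply: contraFN nBA => sAB; rewrite eqEsubset sBA.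
by rewrite /gr_coef ffunE setDv eqxx gr_inv0r expr0 mul1r mulr1 addr0.
Qed.

Lemma gr_mulDl : left_distributive gr_mul +%R.
Proof.
move=> f g h; apply/ffunP=> A; rewrite !ffunE -big_split /=.
by apply: eq_bigr => B _; rewrite /gr_coef ffunE mulrDl mulrDr.
Qed.

Lemma gr_mulDr : right_distributive gr_mul +%R.
Proof.
move=> f g h; apply/ffunP=> A; rewrite !ffunE -big_split /=.
by apply: eq_bigr => B _; rewrite /gr_coef ffunE !mulrDr.
Qed.

Lemma gr_oner_neq0 : gr_const 1 != 0.
Proof.
apply/eqP => /ffunP /(_ set0); rewrite !ffunE eqxx => /eqP.
by rewrite oner_eq0.
Qed.

HB.instance Definition _ := GRing.Zmodule_isNzRing.Build G
  gr_mulA gr_mul1r gr_mulr1 gr_mulDl gr_mulDr gr_oner_neq0.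

End GrassmannRing.

Arguments gr_const {R m} a.
Arguments gr_xi {R m} i.

Lemma gr_xiM (R : comNzRingType) m (i j : 'I_m) :
  (gr_xi i * gr_xi j : grassmann R m) =
  [ffun A : {set 'I_m} => (-1) ^+ (j < i)%N * ((i != j) && (A == [set i; j]))%:R].
Proof.
apply/ffunP=> A; rewrite !ffunE.
under eq_bigr => B _ do rewrite /gr_coef !ffunE -natrM mulnb.
case: (boolP ((i != j) && (A == [set i; j]))) => [/andP[nij /eqP->]|nA].
  rewrite (bigD1 [set i]) ?sub1set ?set21 //=.
  rewrite big1 => [|B /andP[_ /negPf->]]; last by rewrite mulr0.
  have -> : [set i; j] :\: [set i] = [set j].
    by apply/setP=> t; rewrite !inE; case: eqVneq => [->|//]; rewrite (negPf nij).
  by rewrite !eqxx /gr_inv !big_set1 addr0.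
rewrite mulr0 big1 // => B sBA; case: eqP => [EB|_]; last by rewrite mulr0.
case: eqP => [EA|_]; last by rewrite mulr0.
case/negP: nA.
have: j \in A :\: B by rewrite EA set11.
rewrite EB !inE => /andP[ji _]; rewrite (eq_sym i) ji /=.
have iA : i \in A by move: sBA; rewrite EB sub1set.
have AEj : A :\ i = [set j] by rewrite -EB.
by rewrite -(setD1K iA) AEj.
Qed.

Lemma gr_xi_sqr (R : comNzRingType) m (i : 'I_m) :
  (gr_xi i * gr_xi i : grassmann R m) = 0.
Proof. by rewrite gr_xiM; apply/ffunP=> A; rewrite !ffunE eqxx mulr0. Qed.

Lemma gr_xi_anticomm (R : comNzRingType) m (i j : 'I_m) :
  (gr_xi i * gr_xi j : grassmann R m) = - (gr_xi j * gr_xi i).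
Proof.
rewrite !gr_xiM; apply/ffunP=> A; rewrite !ffunE setUC (eq_sym i).
case: eqVneq => [_|nij]; first by rewrite !mulr0 oppr0.
case: (ltngtP i j) => [||/val_inj e];
  rewrite ?expr0 ?expr1 ?mul1r ?mulN1r ?opprK //.
by rewrite e eqxx in nij.
Qed.

Section ExtendedQuivers.
Variables n m : nat.
Implicit Types (k l : 'I_n) (i j : 'I_m).

(* arr u v is the number of arrows x_u -> x_v, and path2 k i j the number of  *)
(* 2-paths xi_i -> x_k -> xi_j.                                               *)
Record hypergraph := Hypergraph {
  arr : 'I_n -> 'I_n -> nat;
  path2 : 'I_n -> 'I_m -> 'I_m -> nat
}.

Implicit Type Q : hypergraph.

Definition no_loop Q : Prop := forall u, arr Q u u = 0%N.

Definition no_2cycle Q : Prop :=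
  forall u v, arr Q u v = 0%N \/ arr Q v u = 0%N.

Definition condition_C Q : Prop :=
  forall k, exists I J : {set 'I_m}, exists N : nat,
    [disjoint I & J] /\
    forall i j, path2 Q k i j = if (i \in I) && (j \in J) then N else 0%N.

Definition extended_quiver Q : Prop :=
  [/\ no_loop Q, no_2cycle Q & condition_C Q].

Definition compose_arr k Q (u v : 'I_n) : nat :=
  (arr Q u v + arr Q u k * arr Q k v)%N.

Definition reverse_arr k (a : 'I_n -> 'I_n -> nat) (u v : 'I_n) : nat :=
  if (u == k) || (v == k) then a v u else a u v.

(* The arrows x_k -> x_l used here are those of the quiver before mutation.   *)
Definition compose_path2 k Q l i j : nat :=
  (path2 Q l i j + path2 Q k i j * arr Q k l)%N.

Definition reverse_path2 k (p : 'I_n -> 'I_m -> 'I_m -> nat) l i j : nat :=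
  if l == k then p l j i else p l i j.

(* The truncated differences cancel opposite arrows, resp. 2-paths, in pairs. *)
Definition mutate k Q : hypergraph :=
  let a := reverse_arr k (compose_arr k Q) in
  let p := reverse_path2 k (compose_path2 k Q) in
  Hypergraph (fun u v => a u v - a v u)%N
             (fun l i j => p l i j - p l j i)%N.

Definition admissible k Q : Prop := condition_C (mutate k Q).

End ExtendedQuivers.

Section Clusters.
Variables (K : fieldType) (n m : nat).

(* Rational functions in the even variables, with the odd variables adjoined. *)
Definition superfun : nzRingType := grassmann {fraction {mpoly K[n]}} m.

Definition superx (k : 'I_n) : superfun := gr_const (tofrac 'X_k).

Definition odd_sum (Q : hypergraph n m) (k : 'I_n) : superfun :=
  \sum_(i < m) \sum_(j < m) (gr_xi i * gr_xi j) *+ path2 Q k i j.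

Definition exchange_rhs (Q : hypergraph n m) (x : 'I_n -> superfun) (k : 'I_n) :
    superfun :=
  \prod_(j < n) x j ^+ arr Q k j +
  (1 + odd_sum Q k) * \prod_(i < n) x i ^+ arr Q i k.

Definition replace (k : 'I_n) (y : superfun) (x : 'I_n -> superfun) :
    'I_n -> superfun :=
  fun l => if l == k then y else x l.

(* In characteristic 0 the xi-free part of each x k is a nonzero rational     *)
(* function, hence x k is invertible, and the exchange relation determines    *)
(* x'k.                                                                       *)
Inductive mutation_seed (Q0 : hypergraph n m) :
    hypergraph n m -> ('I_n -> superfun) -> Prop :=
| Initial_seed : mutation_seed Q0 Q0 superx
| Mutated_seed Q x k x'k of
    mutation_seed Q0 Q x & admissible k Q & x k * x'k = exchange_rhs Q x k :
    mutation_seed Q0 (mutate k Q) (replace k x'k x).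

(* The denominator 'X_[d] is a monomial in the even variables only.           *)
Definition laurent_poly (f : superfun) : Prop :=
  exists (d : 'X_{1..n}) (P : grassmann {mpoly K[n]} m),
    forall A : {set 'I_m}, gr_coef f A = tofrac (gr_coef P A) / tofrac 'X_[d].

End Clusters.

(* Main.v *)
Require Import Defs.
From HB Require Import structures.
From mathcomp Require Import all_boot all_order all_algebra.
From mathcomp Require Import ring zify fraction mpoly.

Set Implicit Arguments.
Unset Strict Implicit.
Unset Printing Implicit Defensive.

Import Order.TTheory GRing.Theory Num.Theory.
Local Open Scope ring_scope.

(* Put y_k = 1 + odd_sum k. Condition (C) makes the odd sums square to zero, and
   since all their combinations occurring in admissible mutations also square to
   zero, in characteristic 0 the y_k mutate multiplicatively: y_k becomes 1 / y_k
   and y_l becomes y_l y_k^(arr k l). So the super exchange relations specialise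
   those of a cluster algebra with free coefficients y_1, ..., y_n, where
   x_k x_k' = prod_out x + y_k prod_in x, and it suffices to prove the Laurent
   phenomenon there.

   For a seed t let W(t,k) be the ring of Laurent polynomials in the y's and x's
   in which x_k is not inverted but x_k' is adjoined, and U(t) the intersection
   of the W(t,k). It contains the cluster of t, so it is enough that U decreases,
   U(mu_k t) <= U(t). Clearly W(mu_k t,k) <= W(t,k). For j <> k, an element f of
   W(mu_k t,j) and W(mu_k t,k) satisfies x_k'^N f, x_j^M f in W(t,j), and x_j, x_k'
   are coprime there: if an arrow joins j and k then x_k' is a unit modulo x_j;
   otherwise one uses that the x's and y's of a seed are algebraically
   independent, which is witnessed by derivations dual to them. *)

(** * Adjacent seeds *)

Section Quivers.
Variables n m : nat.
Implicit Types (Q : hypergraph n m) (k : 'I_n).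

Lemma no_loop_mutate Q k : no_loop (mutate k Q).
Proof. by move=> u /=; rewrite subnn. Qed.

Lemma no_2cycle_mutate Q k : no_2cycle (mutate k Q).
Proof.
move=> u v /=; set a := reverse_arr _ _ u v; set b := reverse_arr _ _ v u.
by case: (leqP a b) => [|/ltnW] /eqP ->; [left | right].
Qed.

End Quivers.

Section Star.
Variables (F : fieldType) (n m : nat).
Implicit Types (Q : hypergraph n m) (y x : 'I_n -> F) (k : 'I_n) (f g : F).

Definition exch Q y x k : F :=
  \prod_(j < n) x j ^+ arr Q k j + y k * \prod_(i < n) x i ^+ arr Q i k.

(** The two monomials of [exch] carry the coefficients 1 and [y k]. An arrow [k -> l] therefore
    contributes a factor [y k] to the new coefficient at [l], and an arrow [l -> k] only a factor
    1. *)
Definition mut_y Q y k (l : 'I_n) : F :=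
  if l == k then (y k)^-1 else y l * y k ^+ arr Q k l.

Definition mut_x Q y x k (l : 'I_n) : F :=
  if l == k then exch Q y x k / x k else x l.

(* Usually the intersection of the Laurent rings of a seed and of its mutation at
   [k]. *)
Inductive star Q y x k : F -> Prop :=
| star1 : star Q y x k 1
| starB f g of star Q y x k f & star Q y x k g : star Q y x k (f - g)
| starM f g of star Q y x k f & star Q y x k g : star Q y x k (f * g)
| star_y i : star Q y x k (y i)
| star_yV i : star Q y x k (y i)^-1
| star_x i : star Q y x k (x i)
| star_xV i of i != k : star Q y x k (x i)^-1
| star_x' : star Q y x k (exch Q y x k / x k).

Section Closure.
Variables (Q : hypergraph n m) (y x : 'I_n -> F) (k : 'I_n).
Local Notation W := (star Q y x k).

Lemma star0 : W 0.
Proof. by rewrite -(subrr 1); apply: starB; apply: star1. Qed.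

Lemma starD f g : W f -> W g -> W (f + g).
Proof.
move=> Wf Wg; rewrite -[g]opprK -[- g]sub0r.
by do 2?apply: starB => //; apply: star0.
Qed.

Lemma starX f e : W f -> W (f ^+ e).
Proof.
move=> Wf; elim: e => [|e IH]; first exact: star1.
by rewrite exprS; apply: starM.
Qed.

Lemma starXV f e : W f^-1 -> W (f ^+ e)^-1.
Proof. by rewrite -exprVn; apply: starX. Qed.

Lemma starMV f g : W f^-1 -> W g^-1 -> W (f * g)^-1.
Proof. by rewrite invfM; apply: starM. Qed.

Lemma star_prod (I : Type) (r : seq I) (P : pred I) (E : I -> F) :
  (forall i, P i -> W (E i)) -> W (\prod_(i <- r | P i) E i).
Proof. by move=> WE; apply: big_ind => //; [apply: star1 | apply: starM]. Qed.

Lemma star_exp_mod f g w e : W f -> W g -> W w ->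
  exists2 w', W w' & (f + g * w) ^+ e = f ^+ e + g * w'.
Proof.
move=> Wf Wg Ww; elim: e => [|e [w' Ww' IH]].
  by exists 0; [apply: star0 | rewrite mulr0 addr0].
exists (f * w' + w * (f + g * w) ^+ e); last by rewrite !exprS IH; ring.
by apply: starD; apply: starM => //; apply: starX; apply: starD => //; apply: starM.
Qed.

(** The hypothesis on [p] and [q] is the form of coprimality used throughout: a fraction that admits
    both denominators already lies in the subring. It passes to powers by peeling off one factor at
    a time. *)
Lemma star_coprimeX p q : W p -> W q ->
  (forall h, W (p * h) -> W (q * h) -> W h) ->
  forall M N h, W (p ^+ M * h) -> W (q ^+ N * h) -> W h.
Proof.
move=> Wp Wq pq.
have pqX M : forall h, W (p ^+ M * h) -> W (q * h) -> W h.
  elim: M => [|M IH] h; first by rewrite mul1r.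
  rewrite exprS -mulrA => ph qh; apply: IH => //; apply: pq => //.
  by rewrite mulrCA; apply: starM => //; apply: starX.
move=> M; elim=> [|N IH] h; first by rewrite mul1r.
rewrite exprS -mulrA => ph qh; apply: IH => //; apply: (pqX M _ _ qh).
by rewrite mulrCA; apply: starM => //; apply: starX.
Qed.

End Closure.

Hint Resolve star1 star0 starB starD starM starX starXV starMV star_y star_yV
  star_x star_xV star_x' star_prod : star.

Section Adjacent.
Variables (Q : hypergraph n m) (y x : 'I_n -> F) (j k : 'I_n).
Hypothesis (noloop : no_loop Q) (no2cycle : no_2cycle Q).
Hypothesis (y_neq0 : forall i, y i != 0) (x_neq0 : forall i, x i != 0).
Hypothesis (neq_jk : j != k).

Local Notation W := (star Q y x j).
Local Notation z := (exch Q y x k / x k).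

(** These monomials are units of [W] and are untouched by mutation at [k]; [x j] is kept apart as
    the modulus and [x k] because [z] replaces it. *)
Local Definition mon (e : 'I_n -> nat) : F :=
  \prod_(i < n | (i != j) && (i != k)) x i ^+ e i.

Lemma star_mon e : W (mon e).
Proof. by rewrite /mon; auto with star. Qed.

Lemma star_monV e : W (mon e)^-1.
Proof.
by rewrite /mon -prodfV; apply: star_prod => i /andP[ij _]; auto with star.
Qed.

Lemma mon_neq0 e : mon e != 0.
Proof. by apply/prodf_neq0 => i _; rewrite expf_neq0. Qed.

Lemma monD e e' : mon (fun i => e i + e' i)%N = mon e * mon e'.
Proof. by rewrite -big_split /=; apply: eq_bigr => i _; rewrite exprD. Qed.

Lemma monX e c : mon (fun i => e i * c)%N = mon e ^+ c.
Proof. by rewrite /mon -prodrXl; apply: eq_bigr => i _; rewrite exprM. Qed.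

Lemma prod_mon (x' : 'I_n -> F) e :
  (forall i, i != j -> i != k -> x' i = x i) ->
  \prod_(i < n) x' i ^+ e i = x' j ^+ e j * x' k ^+ e k * mon e.
Proof.
move=> xx'; rewrite (bigD1 j) // (bigD1 k) 1?eq_sym //= -mulrA; congr (_ * (_ * _)).
by apply: eq_bigr => i /andP[ij ik]; rewrite xx'.
Qed.

Lemma exch_k : exch Q y x k =
  x j ^+ arr Q k j * mon (arr Q k) + y k * (x j ^+ arr Q j k * mon (arr Q^~ k)).
Proof. by rewrite /exch !prod_mon // !noloop !mulr1. Qed.

Lemma exch_j : exch Q y x j =
  x k ^+ arr Q j k * mon (arr Q j) + y j * (x k ^+ arr Q k j * mon (arr Q^~ j)).
Proof. by rewrite /exch !prod_mon // !noloop !mul1r. Qed.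

(** Mutation reverses the arrows between [j] and [k], so [z] appears with the two exponents of [x k]
    exchanged. *)
Lemma exch_j_mut : exch (mutate k Q) (mut_y Q y k) (mut_x Q y x k) j =
  z ^+ arr Q k j * mon (arr (mutate k Q) j) +
  y j * y k ^+ arr Q k j * (z ^+ arr Q j k * mon ((arr (mutate k Q))^~ j)).
Proof.
have xx' i : i != j -> i != k -> mut_x Q y x k i = x i.
  by move=> _ /negPf ik; rewrite /mut_x ik.
rewrite /exch !(prod_mon _ xx') !no_loop_mutate !mul1r.
rewrite /mut_y /mut_x (negPf neq_jk) eqxx /= /reverse_arr /compose_arr !eqxx !orbT.
by rewrite !noloop; case: (no2cycle j k) => ->; rewrite !(muln0, mul0n, addn0, subn0, sub0n).
Qed.

(** For each [i], the signed number of arrows from [j] to [i] changes by the paths [j -> k -> i]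
    minus the paths [i -> k -> j]. Negative terms are moved across so that only natural exponents
    occur. *)
Lemma mon_mut :
  mon (arr (mutate k Q) j) * mon (arr Q^~ j) * mon (arr Q^~ k) ^+ arr Q k j =
  mon (arr Q j) * mon ((arr (mutate k Q))^~ j) * mon (arr Q k) ^+ arr Q j k.
Proof.
rewrite -!monX -!monD /mon; apply: eq_bigr => i /andP[ij ik]; congr (_ ^+ _).
rewrite /= /reverse_arr /compose_arr (negPf ik) (negPf neq_jk) /=.
lia.
Qed.

Lemma z_star : W z.
Proof.
rewrite exch_k; apply: starM; last by apply: star_xV; rewrite eq_sym.
by auto 8 using star_mon with star.
Qed.

(* [z] is congruent to a unit modulo [x j] when an arrow joins [j] and [k]. *)
Lemma z_mod_in : arr Q k j = 0%N -> (0 < arr Q j k)%N ->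
  exists2 w, W w & x k * z = mon (arr Q k) + x j * w.
Proof.
move=> kj0 jk0; exists (y k * (x j ^+ (arr Q j k).-1 * mon (arr Q^~ k))).
  by auto using star_mon with star.
rewrite mulrC divfK // exch_k kj0 expr0 mul1r; congr (_ + _).
by rewrite -{1}(prednK jk0) exprS; ring.
Qed.

Lemma z_mod_out : arr Q j k = 0%N -> (0 < arr Q k j)%N ->
  exists2 w, W w & x k * z = y k * mon (arr Q^~ k) + x j * w.
Proof.
move=> jk0 kj0; exists (x j ^+ (arr Q k j).-1 * mon (arr Q k)).
  by auto using star_mon with star.
rewrite mulrC divfK // exch_k jk0 expr0 mul1r -{1}(prednK kj0) exprS; ring.
Qed.

Lemma zX_mod_in : arr Q k j = 0%N ->
  exists2 w, W w & x k ^+ arr Q j k * z ^+ arr Q j k =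
    mon (arr Q k) ^+ arr Q j k + x j * w.
Proof.
move=> kj0; rewrite -exprMn; case: (posnP (arr Q j k)) => [->|jk0].
  by exists 0; [apply: star0 | rewrite mulr0 addr0].
by have [w Ww ->] := z_mod_in kj0 jk0; apply: star_exp_mod => //;
  [apply: star_mon | apply: star_x].
Qed.

Lemma zX_mod_out : arr Q j k = 0%N ->
  exists2 w, W w & x k ^+ arr Q k j * z ^+ arr Q k j =
    (y k * mon (arr Q^~ k)) ^+ arr Q k j + x j * w.
Proof.
move=> kj0; rewrite -exprMn; case: (posnP (arr Q k j)) => [->|jk0].
  by exists 0; [apply: star0 | rewrite mulr0 addr0].
have [w Ww ->] := z_mod_out kj0 jk0; apply: star_exp_mod => //.
  by auto using star_mon with star.
exact: star_x.
Qed.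

(* Modulo [x j], the exchange polynomial of [j] after mutation at [k] is a unit
   multiple of the one before, which is itself a multiple of [x j]. *)
Lemma second_exch_star :
  W (exch (mutate k Q) (mut_y Q y k) (mut_x Q y x k) j / x j).
Proof.
have xkV e : W (x k ^+ e)^-1 by apply/starXV/star_xV; rewrite eq_sym.
have xk0 e : x k ^+ e != 0 by rewrite expf_neq0.
have yk0 e : y k ^+ e != 0 by rewrite expf_neq0.
have := mon_mut; rewrite exch_j_mut; case: (no2cycle k j) => a0.
  have [w Ww zw] := zX_mod_in a0; have := exch_j; rewrite a0 !expr0.
  set a := arr Q j k in zw *.
  set o' := mon (arr (mutate k Q) j); set i' := mon ((arr (mutate k Q))^~ j).
  set o := mon (arr Q j); set i := mon (arr Q^~ j); set u := mon (arr Q k) in zw *.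
  rewrite !(mulr1, mul1r) => Pj oi.
  have i0 : i != 0 by apply: mon_neq0.
  have -> : o' = o * i' * u ^+ a / i by rewrite -oi mulfK.
  have -> : z ^+ a = (u ^+ a + x j * w) / x k ^+ a
    by apply: (canRL (mulfK _)) => //; rewrite [LHS]mulrC zw.
  (* Inserting the congruence for the power of [z] leaves a unit times the old quotient
     [exch Q y x j / x j], plus a remainder in which [x j] cancels. *)
  have -> : (o * i' * u ^+ a / i + y j * ((u ^+ a + x j * w) / x k ^+ a * i')) / x j =
    i' * u ^+ a / i / x k ^+ a * (exch Q y x j / x j) + y j * i' * w / x k ^+ a.
    by rewrite Pj; field; rewrite xk0 i0 x_neq0.
  by rewrite /o /i /i' /u; auto 12 using star_mon, star_monV with star.
have [w Ww zw] := zX_mod_out a0; have := exch_j; rewrite a0 !expr0.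
set a := arr Q k j in zw *.
set o' := mon (arr (mutate k Q) j); set i' := mon ((arr (mutate k Q))^~ j).
set o := mon (arr Q j); set i := mon (arr Q^~ j); set u := mon (arr Q^~ k) in zw *.
rewrite !(mulr1, mul1r) => Pj oi.
have i0 : i != 0 by apply: mon_neq0.
have u0 : u ^+ a != 0 by rewrite expf_neq0 // mon_neq0.
have -> : o' = o * i' / i / u ^+ a.
  by rewrite -oi; field; rewrite i0 u0.
have -> : z ^+ a = ((y k * u) ^+ a + x j * w) / x k ^+ a
    by apply: (canRL (mulfK _)) => //; rewrite [LHS]mulrC zw.
have -> : (((y k * u) ^+ a + x j * w) / x k ^+ a * (o * i' / i / u ^+ a) +
    y j * y k ^+ a * i') / x j =
  i' / i * y k ^+ a / x k ^+ a * (exch Q y x j / x j) +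
  w / x k ^+ a * o * i' / i / u ^+ a.
  by rewrite Pj exprMn; field; rewrite xk0 i0 x_neq0 u0.
by rewrite /o /i /i' /u; auto 16 using star_mon, star_monV with star.
Qed.

Lemma mut_star_y i : W (mut_y Q y k i).
Proof. by rewrite /mut_y; case: eqP => _; auto with star. Qed.

Lemma mut_star_yV i : W (mut_y Q y k i)^-1.
Proof. by rewrite /mut_y; case: eqP => _; rewrite ?invrK; auto with star. Qed.

(** Membership in the localisation of [W] at the powers of [p]. *)
Local Definition loc p f := exists N, W (p ^+ N * f).

Lemma loc_star p f : W f -> loc p f.
Proof. by exists 0%N; rewrite mul1r. Qed.

Lemma locB p f g : W p -> loc p f -> loc p g -> loc p (f - g).
Proof.
move=> Wp [M Wf] [N Wg]; exists (M + N)%N.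
have -> : p ^+ (M + N) * (f - g) = p ^+ N * (p ^+ M * f) - p ^+ M * (p ^+ N * g).
  by rewrite exprD; ring.
by auto with star.
Qed.

Lemma locM p f g : loc p f -> loc p g -> loc p (f * g).
Proof.
by move=> [M Wf] [N Wg]; exists (M + N)%N; rewrite exprD mulrACA; auto with star.
Qed.

Lemma locV p : loc p p^-1.
Proof.
exists 1%N; have [->|p0] := eqVneq p 0; first by rewrite mul0r; apply: star0.
by rewrite expr1 divff //; apply: star1.
Qed.

(** Among the generators of the ring at the mutated seed only the inverse of [z] needs a
    denominator; the new exchange quotient at [j] is covered by [second_exch_star]. *)
Lemma star_mut_diff_loc f :
  star (mutate k Q) (mut_y Q y k) (mut_x Q y x k) j f -> loc z f.
Proof.
elim=> {f} [|f g _ IHf _ IHg|f g _ IHf _ IHg|i|i|i|i ij|].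
- exact/loc_star/star1.
- exact/locB/IHg/IHf/z_star.
- exact: locM.
- exact/loc_star/mut_star_y.
- exact/loc_star/mut_star_yV.
- by apply: loc_star; rewrite /mut_x; case: eqP => _; [apply: z_star | apply: star_x].
- rewrite /mut_x; case: eqP => [_|_]; first exact: locV.
  exact/loc_star/star_xV.
have -> : mut_x Q y x k j = x j by rewrite /mut_x (negPf neq_jk).
exact/loc_star/second_exch_star.
Qed.

(** Here only the inverse of [x j] needs a denominator, since the exchange quotient at [k] is
    [z]. *)
Lemma star_diff_loc f : star Q y x k f -> loc (x j) f.
Proof.
elim=> {f} [|f g _ IHf _ IHg|f g _ IHf _ IHg|i|i|i|i ij|].
- exact/loc_star/star1.
- exact/locB/IHg/IHf/star_x.
- exact: locM.
- exact/loc_star/star_y.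
- exact/loc_star/star_yV.
- exact/loc_star/star_x.
- by have [->|ne_ij] := eqVneq i j; [apply: locV | apply/loc_star/star_xV].
exact/loc_star/z_star.
Qed.

(** The relation writes the unit [u] as a combination of [z] and [x j], hence [h] as a combination
    of [z * h] and [x j * h]. *)
Lemma bezout_regular u w : W u^-1 -> u != 0 -> W w -> x k * z = u + x j * w ->
  forall h, W (x j * h) -> W (z * h) -> W h.
Proof.
move=> WuV u0 Ww zE h Wxh Wzh.
have -> : h = u^-1 * (x k * (z * h) - w * (x j * h)).
  by rewrite [x k * _]mulrA zE; field.
by auto with star.
Qed.

Lemma star_mut_diff f :
  (arr Q j k = 0%N -> arr Q k j = 0%N ->
    forall h, W (x j * h) -> W (z * h) -> W h) ->
  star (mutate k Q) (mut_y Q y k) (mut_x Q y x k) j f ->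
  star Q y x k f -> W f.
Proof.
move=> reg /star_mut_diff_loc [N WN] /star_diff_loc [M WM].
apply: star_coprimeX WM WN; [exact: star_x | exact: z_star |].
case: (no2cycle j k) => a0; last first.
  case: (posnP (arr Q j k)) => [b0|b0]; first exact: reg.
  have [w Ww zw] := z_mod_in a0 b0.
  exact: bezout_regular (star_monV _) (mon_neq0 _) Ww zw.
case: (posnP (arr Q k j)) => [b0|b0]; first exact: reg.
have [w Ww zw] := z_mod_out a0 b0.
apply: bezout_regular Ww zw; last by rewrite mulf_neq0 // mon_neq0.
exact/starMV/star_monV/star_yV.
Qed.

End Adjacent.

(** All arrows at [k] are reversed, so the two monomials trade places while the coefficient becomes
    its inverse. *)
Lemma exch_mut_same Q y x k : no_loop Q -> no_2cycle Q -> y k != 0 ->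
  exch (mutate k Q) (mut_y Q y k) (mut_x Q y x k) k = (y k)^-1 * exch Q y x k.
Proof.
move=> noloop no2cycle yk0.
have arr_k i : (arr (mutate k Q) k i = arr Q i k) * (arr (mutate k Q) i k = arr Q k i).
  rewrite /= /reverse_arr /compose_arr !eqxx !orbT !noloop !(muln0, mul0n, addn0).
  by case: (no2cycle i k) => ->; rewrite subn0 sub0n.
(* Without loops the new variable at [k] only occurs with exponent 0. *)
have mut_xX i e : (i = k -> e = 0%N) -> mut_x Q y x k i ^+ e = x i ^+ e.
  by rewrite /mut_x; case: eqP => // -> ->.
rewrite /exch /mut_y eqxx.
rewrite (eq_bigr (fun i => x i ^+ arr Q i k)) => [|i _]; last first.
  by rewrite arr_k mut_xX // => ->.
rewrite [in X in _ + X](eq_bigr (fun i => x i ^+ arr Q k i)) => [|i _]; last first.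
  by rewrite arr_k mut_xX // => ->.
by field.
Qed.

(** Mutating twice at [k] gives back [x k] up to the unit [(y k)^-1]. *)
Lemma star_mut_same Q y x k f : no_loop Q -> no_2cycle Q ->
  y k != 0 -> x k != 0 ->
  star (mutate k Q) (mut_y Q y k) (mut_x Q y x k) k f -> star Q y x k f.
Proof.
move=> noloop no2cycle yk0 xk0.
elim=> {f} [|f g _ IHf _ IHg|f g _ IHf _ IHg|i|i|i|i ik|]; auto with star.
- by rewrite /mut_y; case: eqP => _; auto with star.
- by rewrite /mut_y; case: eqP => _; rewrite ?invrK; auto with star.
- by rewrite /mut_x; case: eqP => _; auto with star.
- by rewrite /mut_x (negPf ik); auto with star.
rewrite exch_mut_same // /mut_x eqxx.
(* The exchange polynomial may vanish here; the quotient is then 0. *)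
have [->|P0] := eqVneq (exch Q y x k) 0; first by rewrite mulr0 mul0r; apply: star0.
have -> : (y k)^-1 * exch Q y x k / (exch Q y x k / x k) = (y k)^-1 * x k.
  by field; rewrite yk0 xk0 P0.
by auto with star.
Qed.

End Star.

(** * Algebraic independence through derivations *)

Lemma intr_pchar0_eq0 (L : fieldType) (z : int) :
  [pchar L] =i pred0 -> z%:~R = 0 :> L -> z = 0.
Proof.
move=> /pcharf0P charL; case: z => k /eqP; rewrite ?NegzE ?mulrNz ?oppr_eq0 charL.
  by move=> /eqP ->.
by [].
Qed.

Section Derivations.
Variable F : fieldType.
Implicit Types (D : F -> F) (f g : F).

Definition derivation D : Prop :=
  (forall f g, D (f - g) = D f - D g) /\
  (forall f g, D (f * g) = D f * g + f * D g).

Section Rules.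
Variables (D : F -> F) (dD : derivation D).

Lemma der0 : D 0 = 0.
Proof. by rewrite -[in LHS](subrr 0) dD.1 subrr. Qed.

Lemma der1 : D 1 = 0.
Proof.
by have := dD.2 1 1; rewrite !mulr1 mul1r -[in LHS](addr0 (D 1)) => /addrI.
Qed.

Lemma derN f : D (- f) = - D f.
Proof. by rewrite -sub0r dD.1 der0 sub0r. Qed.

Lemma derD f g : D (f + g) = D f + D g.
Proof. by rewrite -[g in LHS]opprK dD.1 derN opprK. Qed.

Lemma derV f : f != 0 -> D f^-1 = - D f / f ^+ 2.
Proof.
move=> f0; have := dD.2 f f^-1; rewrite divff // der1 => e.
have {}e : f * D f^-1 = - (D f / f) by rewrite -[LHS](addKr (D f / f)) -e addr0.
by rewrite -[LHS](mulKf f0) e expr2 invfM; ring.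
Qed.

Lemma derX f e : D (f ^+ e) = e%:R * f ^+ e.-1 * D f.
Proof.
elim: e => [|e IH]; first by rewrite der1 !mul0r.
rewrite exprS dD.2 IH /= -natr1; case: e {IH} => [|e] /=; first by ring.
by rewrite exprS; ring.
Qed.

Lemma der_prod_eq0 (I : Type) (r : seq I) (P : pred I) (E : I -> F) :
  (forall i, P i -> D (E i) = 0) -> D (\prod_(i <- r | P i) E i) = 0.
Proof.
move=> DE; elim/big_ind: _ => //; first exact: der1.
by move=> f g Df Dg; rewrite dD.2 Df Dg mul0r mulr0 addr0.
Qed.

Lemma der_int z : D z%:~R = 0.
Proof.
have Dn k : D k%:R = 0.
  by elim: k => [|k IH]; [apply: der0 | rewrite -natr1 derD IH der1 addr0].
by case: z => k; rewrite ?NegzE ?mulrNz ?derN Dn ?oppr0.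
Qed.

Lemma derivation_scale c : derivation (fun f => c * D f).
Proof.
by split=> f g; rewrite ?dD.1 ?dD.2; ring.
Qed.

End Rules.

Lemma derivation_add D D' : derivation D -> derivation D' ->
  derivation (fun f => D f + D' f).
Proof. by move=> dD dD'; split=> f g; rewrite ?dD.1 ?dD'.1 ?dD.2 ?dD'.2; ring. Qed.

Lemma derivation_sum (I : Type) (r : seq I) (P : pred I) (D : I -> F -> F) :
  (forall i, derivation (D i)) -> derivation (fun f => \sum_(i <- r | P i) D i f).
Proof.
move=> dD; elim: r => [|i r IH].
  by split=> f g; rewrite !big_nil ?subrr ?mul0r ?mulr0 ?addr0.
split=> f g; rewrite !big_cons; case: (P i); rewrite ?IH.1 ?IH.2 //.
  by rewrite (dD i).1; ring.
by rewrite (dD i).2; ring.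
Qed.

(* Certifies that [v] is algebraically independent over the integers
   ([dual_free]), in a form that passes from a seed to its mutations. *)
Definition dual (I : eqType) (v : I -> F) (D : I -> F -> F) : Prop :=
  (forall i, derivation (D i)) /\ forall i j, D i (v j) = (i == j)%:R.

Lemma dual_neq0 (I : eqType) (v : I -> F) (D : I -> F -> F) i : dual v D -> v i != 0.
Proof.
move=> [dD /(_ i i)]; rewrite eqxx; apply: contra_eq_neq => ->.
by rewrite der0 // eq_sym oner_eq0.
Qed.

(** A step of Gaussian elimination: [D p] is rescaled to take the value 1 on [z], and multiples of
    it are subtracted from the other derivations so that they kill [z]. *)
Lemma dual_replace (I : eqType) (v : I -> F) (D : I -> F -> F) p z :
  dual v D -> D p z != 0 ->
  exists D' : I -> F -> F, dual (fun i => if i == p then z else v i) D'.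
Proof.
move=> [dD Dv] Dz0.
exists (fun i => if i == p then fun f => (D p z)^-1 * D p f
  else fun f => D i f + - (D i z / D p z) * D p f).
split=> [i|i j].
  case: eqP => _; first exact: derivation_scale.
  by apply: derivation_add => //; apply: derivation_scale.
have [->|ip] := eqVneq i p; case: (eqVneq j p) => [e|jp] /=.
- by rewrite mulVf.
- by rewrite Dv eq_sym (negPf jp) mulr0.
- by rewrite e mulNr divfK // subrr (negPf ip).
by rewrite !Dv [p == j]eq_sym (negPf jp) mulr0 addr0.
Qed.

(** Each [D i] acts on values of polynomials as the formal partial derivative. By induction on the
    degree all partial derivatives of a relation vanish, so the relation is constant, and
    characteristic 0 makes the constant zero. *)
Lemma dual_free N (v : 'I_N -> F) (D : 'I_N -> F -> F) (p : {mpoly int[N]}) :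
  [pchar F] =i pred0 -> dual v D -> mmap intr v p = 0 -> p = 0.
Proof.
move=> charF [dD Dv].
have Dm i q : D i (mmap intr v q) = mmap intr v (mderiv i q).
  elim/mpolyind: q => [|c e q _ _ IH].
    by rewrite linear0 !raddf0 der0.
  rewrite !raddfD /= derD // IH; congr (_ + _).
  rewrite -!mul_mpolyC mderiv_mulC !rmorphM /= !mmapC (dD i).2 (der_int (dD i)) mul0r add0r.
  congr (_ * _); rewrite mderivX mmapZ !mmapX /mmap1.
  rewrite (bigD1 i) //= (dD i).2 (der_prod_eq0 (dD i)) => [|j ji]; last first.
    by rewrite (derX (dD i)) Dv eq_sym (negPf ji) mulr0.
  rewrite mulr0 addr0 (derX (dD i)) Dv eqxx mulr1 [in RHS](bigD1 i) //= mulrA.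
  rewrite mnmBE mnm1E eqxx subn1.
  congr (_ * _); first by rewrite rmorph_nat.
  by apply: eq_bigr => j ji; rewrite mnmBE mnm1E eq_sym (negPf ji) subn0.
(* The bound is strict, so that [d = 0] forces [p = 0]. *)
have: exists d, forall e, (d <= mdeg e)%N -> p@_e = 0.
  by exists (msize p) => e /msize_mdeg_ge; rewrite mcoeff_msupp negbK => /eqP.
move=> [d]; elim: d p => [|d IH] p pd vp.
  by apply/mpolyP => e; rewrite pd // mcoeff0.
have dp0 i : mderiv i p = 0.
  apply: IH => [e de|]; last by rewrite -Dm vp der0.
  by rewrite mcoeff_deriv pd ?mul0rn // mdegD mdeg1 addn1 ltnS.
have pC e : e != 0%MM -> p@_e = 0.
  move=> e0; have [i ei] : exists i, e i != 0%N.
    apply/existsP; apply: contraNT e0; rewrite negb_exists => /forallP e0.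
    by apply/eqP/mnmP => i; rewrite mnm0E; apply/eqP; have := e0 i; rewrite negbK.
  (* This coefficient of the derivative is [p@_e] times the positive integer [e i]. *)
  have /mpolyP /(_ (e - U_(i))%MM) := dp0 i.
  rewrite mcoeff0 mcoeff_deriv submK ?lep1mP // => /eqP.
  by rewrite -mulr_natr mulf_eq0 pnatr_eq0 orbF => /eqP.
have {pC} pE : p = (p@_0)%:MP.
  apply/mpolyP => e; rewrite mcoeffC; have [->|e0] := eqVneq e 0%MM; first by rewrite mulr1.
  by rewrite pC // mulr0.
by move: vp; rewrite pE mmapC => /(intr_pchar0_eq0 charF) ->; rewrite mpolyC0.
Qed.

End Derivations.

(** * Algebraically independent seeds and their mutations *)

Section FreeSeeds.
Variables (F : fieldType) (n m : nat).
Implicit Types (Q : hypergraph n m) (y x : 'I_n -> F) (k : 'I_n).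

Definition seed_fam x y (i : 'I_n + 'I_n) : F :=
  match i with inl a => x a | inr a => y a end.

Definition free_seed x y : Prop := exists D, dual (seed_fam x y) D.

Lemma dual_ext (I : eqType) (v v' : I -> F) (D : I -> F -> F) :
  v =1 v' -> dual v D -> dual v' D.
Proof. by move=> vv' [dD Dv]; split=> // i j; rewrite -vv'. Qed.

Lemma free_seed_neq0 x y : free_seed x y ->
  (forall i, x i != 0) * (forall i, y i != 0).
Proof.
move=> [D dualD]; split=> i.
  exact: (dual_neq0 (inl i) dualD).
exact: (dual_neq0 (inr i) dualD).
Qed.

Lemma der_monomial (D : F -> F) x (e : 'I_n -> nat) : derivation D ->
  (forall i, e i != 0%N -> D (x i) = 0) -> D (\prod_i x i ^+ e i) = 0.
Proof.
move=> dD Dx; apply: der_prod_eq0 => // i _; rewrite derX //.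
by case: (eqVneq (e i) 0%N) => [->|/Dx ->]; rewrite ?mul0r ?mulr0.
Qed.

(** The derivation dual to [y k] sends the exchange polynomial to its second monomial, which is
    nonzero. *)
Lemma exch_neq0 Q x y k : free_seed x y -> exch Q y x k != 0.
Proof.
move=> fxy; have [x0 y0] := free_seed_neq0 fxy; have [D [dD Dv]] := fxy.
apply/eqP => P0; have := Dv (inr k) (inr k).
have dDk := dD (inr k); have := congr1 (D (inr k)) P0.
rewrite /exch (derD dDk) dDk.2 !(der_monomial dDk) ?(der0 dDk) => [|i _|i _]; last 2 first.
- exact: Dv (inr k) (inl i).
- exact: Dv (inr k) (inl i).
rewrite mulr0 addr0 add0r => /eqP; rewrite mulf_eq0 [X in _ || X]negbTE ?orbF.
  by move=> /eqP /= ->; rewrite eqxx => /eqP; rewrite eq_sym oner_eq0.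
by apply/prodf_neq0 => i _; rewrite expf_neq0.
Qed.

(** Without loops the derivation dual to [x k] kills the exchange polynomial [P], so it sends
    [P / x k] to [- P / x k ^+ 2], which is nonzero. *)
Lemma free_mut_x Q x y k : no_loop Q -> free_seed x y ->
  free_seed (mut_x Q y x k) y.
Proof.
move=> noloop fxy; have [x0 y0] := free_seed_neq0 fxy; have P0 := exch_neq0 Q k fxy.
have [D dualD] := fxy; have [dD Dv] := dualD; have dDk := dD (inl k).
have Dkx i : D (inl k) (x i) = (k == i)%:R by exact: Dv (inl k) (inl i).
have Dky i : D (inl k) (y i) = 0 by exact: Dv (inl k) (inr i).
have DP : D (inl k) (exch Q y x k) = 0.
  rewrite /exch (derD dDk) dDk.2 Dky !(der_monomial dDk) => [|i|i].
  - by rewrite mul0r mulr0 !addr0.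
  - by rewrite Dkx; case: (eqVneq k i) => [<-|//]; rewrite noloop.
  by rewrite Dkx; case: (eqVneq k i) => [<-|//]; rewrite noloop.
have Dz0 : D (inl k) (exch Q y x k / x k) != 0.
  rewrite dDk.2 DP mul0r add0r (derV dDk) // Dkx eqxx.
  by rewrite !mulf_neq0 // ?invr_eq0 ?expf_neq0 // oppr_eq0 oner_eq0.
have [D' dualD'] := dual_replace dualD Dz0; exists D'.
by apply: dual_ext dualD' => -[] i.
Qed.

Lemma free_mut_y Q x y k : no_loop Q -> free_seed x y ->
  free_seed x (mut_y Q y k).
Proof.
move=> noloop fxy; have [x0 y0] := free_seed_neq0 fxy; have [D [dD Dv]] := fxy.
have Dxx i j : D (inl i) (x j) = (i == j)%:R by exact: Dv (inl i) (inl j).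
have Dxy i j : D (inl i) (y j) = 0 by exact: Dv (inl i) (inr j).
have Dyx i j : D (inr i) (x j) = 0 by exact: Dv (inr i) (inl j).
have Dyy i j : D (inr i) (y j) = (i == j)%:R by exact: Dv (inr i) (inr j).
(* Chain rule: with [y'] the new coefficients, [y k] is the inverse of [y' k], and [y i] is [y' i]
   times the power [arr Q k i] of [y' k] for the other [i]. *)
exists (fun i => match i with
  | inl a => D (inl a)
  | inr l => if l == k then fun f => - y k ^+ 2 * D (inr k) f +
      \sum_(i < n) (arr Q k i)%:R * y k * y i * D (inr i) f
    else fun f => (y k ^+ arr Q k l)^-1 * D (inr l) f end).
split.
  case=> i; first exact: dD.
  case: eqP => _; last exact: derivation_scale.
  apply: derivation_add; first exact: derivation_scale.
  by apply: derivation_sum => l; apply: derivation_scale.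
have inrE a b : (inr a == inr b :> 'I_n + 'I_n) = (a == b) by [].
have DykV i : D i (y k)^-1 = - D i (y k) / y k ^+ 2 by apply: derV.
case=> i; case=> j /=.
- by rewrite Dxx.
- rewrite /mut_y; case: eqP => _; first by rewrite DykV Dxy oppr0 mul0r.
  by rewrite (dD _).2 (derX (dD _)) !Dxy mul0r !mulr0 addr0.
- case: eqP => _; last by rewrite Dyx mulr0.
  by rewrite Dyx mulr0 big1 ?addr0 // => l _; rewrite Dyx mulr0.
have [->|ik] := eqVneq i k; rewrite /mut_y; have [->|jk] := eqVneq j k.
- rewrite DykV Dyy !eqxx big1 ?addr0 => [|l _]; last first.
    rewrite DykV Dyy; case: eqP => [->|_]; first by rewrite noloop !mul0r.
    by rewrite oppr0 mul0r mulr0.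
  by field; apply: y0.
- rewrite (bigD1 j) //= big1 ?addr0 => [|l lj]; last first.
    rewrite (dD _).2 (derX (dD _)) !Dyy (negPf lj) mul0r add0r.
    by case: eqP => [->|_]; rewrite ?noloop ?mul0r ?mulr0 ?mul0r.
  have kj : (k == j) = false by rewrite eq_sym; apply: negPf.
  rewrite inrE !(dD _).2 !(derX (dD _)) !Dyy !eqxx (negPf jk) kj.
  by case: (arr Q k j) => [|a]; rewrite ?exprS /=; ring.
- by rewrite DykV Dyy (negPf ik) oppr0 mul0r mulr0 inrE (negPf ik).
rewrite (dD _).2 (derX (dD _)) !Dyy (negPf ik) !mulr0 addr0.
rewrite inrE; case: eqVneq => [->|_]; last by rewrite !mul0r mulr0.
by rewrite mul1r mulVf // expf_neq0.
Qed.

End FreeSeeds.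

(** * Reduction modulo [x j], and coprimality when no arrow joins [j] and [k] *)

Section Kill.
Variables (N : nat) (j : 'I_N).
Local Notation T := {mpoly int[N]}.

Definition kill : T -> T :=
  mmap (@mpolyC N int) (fun i => if i == j then 0 else 'X_i).
HB.instance Definition _ := GRing.RMorphism.copy kill
  (mmap (@mpolyC N int) (fun i => if i == j then 0 else 'X_i)).

Lemma killXU i : i != j -> kill 'X_i = 'X_i.
Proof. by rewrite /kill mmapX mmap1U => /negPf ->. Qed.

Lemma kill_mod p : exists q, p = kill p + 'X_j * q.
Proof.
elim/mpolyind: p => [|c e p _ _ [q qE]].
  by exists 0; rewrite rmorph0 mulr0 addr0.
suff [r rE] : exists r, 'X_[e] = kill 'X_[e] + 'X_j * r.
  exists (c *: r + q); rewrite rmorphD /= {1}qE {1}rE -!mul_mpolyC rmorphM /=.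
  rewrite [kill c%:MP]mmapC; ring.
have [ej0|ej0] := eqVneq (e j) 0%N.
  exists 0; rewrite mulr0 addr0 /kill mmapX -mmap1_id.
  by apply: eq_bigr => i _; case: eqP => // ->; rewrite ej0 !expr0.
exists 'X_[e - U_(j)]; rewrite -mpolyXD addmC submK ?lep1mP //.
rewrite /kill mmapX /mmap1 (bigD1 j) //= eqxx expr0n (negPf ej0) mul0r add0r //.
Qed.

End Kill.

Section Regular.
Variables (F : fieldType) (n m : nat) (Q : hypergraph n m) (y x : 'I_n -> F).
Variables (j k : 'I_n).
Hypothesis charF : [pchar F] =i pred0.
Hypothesis (noloop : no_loop Q) (free_xy : free_seed x y) (neq_jk : j != k).

Local Notation W := (star Q y x j).
Local Notation T := {mpoly int[n + n]}.
Local Notation Xv := (fun i : 'I_n => 'X_(lshift n i) : T).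
Local Notation Yv := (fun i : 'I_n => 'X_(rshift n i) : T).
Local Notation zeta := (kill (lshift n j)).

(* The exchange relation makes [y j] a rational function of this family. *)
Local Definition exch_fam (i : 'I_(n + n)) : F :=
  seed_fam x (fun l => if l == j then exch Q y x j / x j else y l) (split i).

Local Notation ev := (mmap intr exch_fam : T -> F).

Let x0 := (free_seed_neq0 free_xy).1.
Let y0 := (free_seed_neq0 free_xy).2.

Lemma ev_Xv i : ev (Xv i) = x i.
Proof. by rewrite mmapX mmap1U /exch_fam (unsplitK (inl i)). Qed.

Lemma ev_Yv i : ev (Yv i) = if i == j then exch Q y x j / x j else y i.
Proof. by rewrite mmapX mmap1U /exch_fam (unsplitK (inr i)). Qed.

Local Definition Mv (e : 'I_n -> nat) : T := \prod_i Xv i ^+ e i.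

Lemma ev_Mv e : ev (Mv e) = \prod_i x i ^+ e i.
Proof.
by rewrite rmorph_prod; apply: eq_bigr => i _; rewrite rmorphXn /= ev_Xv.
Qed.

Lemma kill_Mv e : e j = 0%N -> zeta (Mv e) = Mv e.
Proof.
move=> ej; rewrite rmorph_prod; apply: eq_bigr => i _; rewrite rmorphXn /=.
by case: (eqVneq i j) => [->|ij]; rewrite ?ej // killXU // eq_lshift.
Qed.

Lemma kill_Xv i : i != j -> zeta (Xv i) = Xv i.
Proof. by move=> ij; rewrite killXU // eq_lshift. Qed.

Lemma kill_Yv i : zeta (Yv i) = Yv i.
Proof. by rewrite killXU // eq_rlshift. Qed.

Lemma kill_Xvj : zeta (Xv j) = 0.
Proof. by rewrite /kill mmapX mmap1U eqxx. Qed.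

(** The family stays algebraically independent when the exchange quotient replaces [y j]: the
    derivation dual to [y j] sends this quotient to a monomial divided by [x j]. *)
Lemma ev_inj (p : T) : ev p = 0 -> p = 0.
Proof.
have [D dualD] := free_xy; have [dD Dv] := dualD; have dDj := dD (inr j).
have Dx i : D (inr j) (x i) = 0 by exact: Dv (inr j) (inl i).
have Dy : D (inr j) (y j) = 1 by rewrite (Dv (inr j) (inr j)) eqxx.
have Dz0 : D (inr j) (exch Q y x j / x j) != 0.
  rewrite dDj.2 (derV dDj) // Dx oppr0 mul0r mulr0 addr0 mulf_neq0 ?invr_eq0 //.
  rewrite /exch (derD dDj) dDj.2 Dy !(der_monomial dDj) // add0r mulr0 addr0 mul1r.
  by apply/prodf_neq0 => i _; rewrite expf_neq0.
have [D' dualD'] := dual_replace dualD Dz0.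
apply: (@dual_free F _ _ (fun i => D' (split i))) => //.
case: dualD' => dD' Dv'; split=> // a b.
rewrite -(can_eq (@splitK n n)) -Dv' /exch_fam.
by case: (split b).
Qed.

Lemma Mv_neq0 e : Mv e != 0.
Proof.
apply/eqP => /(congr1 ev); rewrite ev_Mv rmorph0; apply/eqP.
by apply/prodf_neq0 => i _; rewrite expf_neq0.
Qed.

Lemma star_ev p : W (ev p).
Proof.
have Wint c : W c%:~R.
  have Wn e : W e%:R.
    by elim: e => [|e IH]; [apply: star0 | rewrite -natr1; apply/starD/star1].
  case: c => e; first exact: Wn.
  by rewrite NegzE mulrNz -sub0r; apply: starB; [apply: star0 | apply: Wn].
have Wv i : W (exch_fam i).
  rewrite /exch_fam; case: (split i) => l /=; first exact: star_x.
  by case: eqP => _; [apply: star_x' | apply: star_y].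
rewrite /mmap; apply: big_ind => [||e _]; [exact: star0 | by apply: starD |].
by apply: starM => //; apply: star_prod => i _; apply: starX.
Qed.

(** The numerator of [y j] over the monomial of incoming arrows, from the exchange relation at
    [j]. *)
Local Definition num_yj : T := Xv j * Yv j - Mv (arr Q j).

Lemma ev_num_yj : ev num_yj = y j * ev (Mv (arr Q ^~ j)).
Proof.
rewrite rmorphB rmorphM /= ev_Xv ev_Yv eqxx !ev_Mv mulrC divfK //.
by rewrite /exch [LHS]addrAC subrr add0r.
Qed.

Lemma star_MvV e : e j = 0%N -> W (ev (Mv e))^-1.
Proof.
move=> ej; rewrite ev_Mv -prodfV; apply: star_prod => i _.
have [->|ij] := eqVneq i j; first by rewrite ej expr0 invr1; apply: star1.
exact/starXV/star_xV.
Qed.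

(** Elements of [W] are fractions of polynomials in [exch_fam] whose denominator is a unit of [W];
    [zeta w != 0] says that this denominator is not divisible by the variable of [x j]. *)
Lemma star_num f : W f -> exists w p : T,
  [/\ zeta w != 0, W (ev w)^-1 & ev w * f = ev p].
Proof.
have triv g p : g = ev p -> exists w p : T,
    [/\ zeta w != 0, W (ev w)^-1 & ev w * g = ev p].
  by move=> ->; exists 1, p; rewrite !rmorph1 mul1r invr1 oner_eq0; split=> //; apply: star1.
elim=> {f} [|f g _ [w [p [w0 Ww wf]]] _ [w' [p' [w0' Ww' wg]]]|
  f g _ [w [p [w0 Ww wf]]] _ [w' [p' [w0' Ww' wg]]]|i|i|i|i ij|].
- by apply: (triv _ 1); rewrite rmorph1.
- exists (w * w'), (p * w' - w * p'); rewrite rmorphM /= mulf_neq0 //.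
  split=> //; first by rewrite rmorphM /=; apply: starMV.
  by rewrite rmorphB !rmorphM /= -wf -wg; ring.
- exists (w * w'), (p * p'); rewrite rmorphM /= mulf_neq0 //.
  split=> //; first by rewrite rmorphM /=; apply: starMV.
  by rewrite !rmorphM /= -wf -wg; ring.
- have [->|ij] := eqVneq i j; last by apply: (triv _ (Yv i)); rewrite ev_Yv (negPf ij).
  exists (Mv (arr Q ^~ j)), num_yj.
  rewrite kill_Mv ?noloop // Mv_neq0 ev_num_yj mulrC; split=> //.
  by apply: star_MvV; apply: noloop.
- have [->|ij] := eqVneq i j.
    exists num_yj, (Mv (arr Q ^~ j)); rewrite ev_num_yj mulrAC divff // mul1r.
    split=> //; last by apply: starMV; [apply: star_yV | apply: star_MvV; apply: noloop].
    (* Modulo [x j] the numerator of [y j] is minus the monomial of outgoing arrows. *)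
    rewrite rmorphB rmorphM /= kill_Xvj mul0r sub0r oppr_eq0 kill_Mv ?noloop //.
    exact: Mv_neq0.
  exists (Yv i), 1; rewrite kill_Yv ev_Yv (negPf ij) rmorph1 divff //.
  split=> //; last exact: star_yV.
  apply/eqP => /(congr1 ev); rewrite ev_Yv (negPf ij) rmorph0; exact/eqP.
- by apply: (triv _ (Xv i)); rewrite ev_Xv.
- exists (Xv i), 1; rewrite kill_Xv // ev_Xv rmorph1 divff //.
  split=> //; last exact: star_xV.
  by apply/eqP => /(congr1 ev); rewrite ev_Xv rmorph0; apply/eqP.
by apply: (triv _ (Yv j)); rewrite ev_Yv eqxx.
Qed.

(* In terms of [exch_fam] the exchange polynomial of [k] does not involve [x j],
   hence it is regular modulo [x j]. *)
Lemma exch_regular : arr Q j k = 0%N -> arr Q k j = 0%N ->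
  forall h, W (x j * h) -> W (exch Q y x k / x k * h) -> W h.
Proof.
move=> jk0 kj0 h Wxh Wzh.
have {Wzh} WPh : W (exch Q y x k * h).
  rewrite (_ : _ * h = x k * (exch Q y x k / x k * h)); last by field.
  by apply: starM => //; apply: star_x.
have [w1 [p1 [w10 Ww1 E1]]] := star_num Wxh.
have [w2 [p2 [w20 _ E2]]] := star_num WPh.
pose pk := Mv (arr Q k) + Yv k * Mv (arr Q ^~ k).
have evpk : ev pk = exch Q y x k.
  by rewrite rmorphD rmorphM /= !ev_Mv ev_Yv eq_sym (negPf neq_jk).
have killpk : zeta pk = pk by rewrite rmorphD rmorphM /= kill_Yv !kill_Mv.
have pk0 : pk != 0.
  by apply/eqP => /(congr1 ev); rewrite evpk rmorph0; apply/eqP; apply: exch_neq0.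
(* Both sides evaluate to the same multiple of [h]. Reducing the identity modulo [x j] kills the
   right-hand side but neither [pk] nor [w2], so [p1] is divisible by the variable of [x j]. *)
have key : pk * w2 * p1 = Xv j * w1 * p2.
  apply/eqP; rewrite -subr_eq0; apply/eqP/ev_inj.
  by rewrite rmorphB !rmorphM /= -E1 -E2 evpk ev_Xv; ring.
have kp1 : zeta p1 = 0.
  have := congr1 zeta key; rewrite !rmorphM /= killpk kill_Xvj !mul0r => /eqP.
  by rewrite !mulf_eq0 (negPf pk0) (negPf w20) => /eqP.
have w1ne0 : ev w1 != 0.
  by apply/eqP => /ev_inj e; rewrite e rmorph0 eqxx in w10.
have [q qE] := kill_mod (lshift n j) p1.
have -> : h = (ev w1)^-1 * ev q.
  move: E1; rewrite qE kp1 add0r rmorphM /= ev_Xv mulrCA => /(mulfI (x0 j)) <-.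
  by rewrite mulKf.
by apply: starM => //; apply: star_ev.
Qed.

End Regular.

(** * The generic seed and its specialisations *)

Section FieldIdentities.
Variable K : fieldType.
Implicit Types (a b c e : K).

Lemma quotient_rule_wd a b q da db dq : b != 0 -> q != 0 ->
  (q * ((da * q + a * dq - a * q / b * db) / b) - a * q / b * dq) / q ^+ 2 =
  (b * da - a * db) / b ^+ 2.
Proof. by move=> b0 q0; field; rewrite b0 q0. Qed.

Lemma subr_frac a b c e : b != 0 -> e != 0 ->
  a / b - c / e = (a * e - c * b) / (b * e).
Proof. by move=> b0 e0; field; rewrite b0 e0. Qed.

Lemma quotient_ruleB a b c e da db dc de : b != 0 -> e != 0 ->
  (b * e * (da * e + a * de - (dc * b + c * db)) -
    (a * e - c * b) * (db * e + b * de)) / (b * e) ^+ 2 =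
  (b * da - a * db) / b ^+ 2 - (e * dc - c * de) / e ^+ 2.
Proof. by move=> b0 e0; field; rewrite b0 e0. Qed.

Lemma quotient_ruleM a b c e da db dc de : b != 0 -> e != 0 ->
  (b * e * (da * c + a * dc) - a * c * (db * e + b * de)) / (b * e) ^+ 2 =
  (b * da - a * db) / b ^+ 2 * (c / e) + a / b * ((e * dc - c * de) / e ^+ 2).
Proof. by move=> b0 e0; field; rewrite b0 e0. Qed.

End FieldIdentities.

Section FractionDerivation.
Variable R : idomainType.
Local Notation F := {fraction R}.
Local Open Scope quotient_scope.

Lemma fracE (f : F) : f = tofrac \n_(repr f) / tofrac \d_(repr f).
Proof.
have d0 := denom_ratioP (repr f).
apply: (canRL (mulfK _)); first by rewrite tofrac_eq0.
rewrite -[X in X * _]reprK; unlock FracField.tofrac; rewrite -[LHS]FracField.pi_mul.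
apply/eqmodP => /=.
rewrite FracField.equivfE /FracField.mulf !numden_Ratio ?oner_neq0 ?mulf_neq0 ?oner_neq0 //.
by apply/eqP; ring.
Qed.

Variables (d : R -> R).
Hypothesis dB : forall p q, d (p - q) = d p - d q.
Hypothesis dM : forall p q, d (p * q) = d p * q + p * d q.

Definition quotient_rule (p q : R) : F :=
  (tofrac q * tofrac (d p) - tofrac p * tofrac (d q)) / tofrac q ^+ 2.

Definition frac_der (f : F) : F := quotient_rule \n_(repr f) \d_(repr f).

(** Independence of the representative [a / b]: the Leibniz rule applied to [p * b = a * q]
    determines [d p]. *)
Lemma frac_derE p q : q != 0 -> frac_der (tofrac p / tofrac q) = quotient_rule p q.
Proof.
move=> q0; rewrite /frac_der; set f := tofrac p / _.
have := fracE f; have := denom_ratioP (repr f).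
set a := \n_(repr f); set b := \d_(repr f) => b0 fE.
have q0F : tofrac q != 0 by rewrite tofrac_eq0.
have b0F : tofrac b != 0 by rewrite tofrac_eq0.
have pE : tofrac p = tofrac a * tofrac q / tofrac b.
  by rewrite mulrAC -fE /f divfK.
have dpE : tofrac (d p) =
    (tofrac (d a) * tofrac q + tofrac a * tofrac (d q) - tofrac p * tofrac (d b)) / tofrac b.
  apply: (canRL (mulfK b0F)); apply: (canRL (addrK _)).
  rewrite -!tofracM -!tofracD -!dM; congr (tofrac (d _)).
  by apply/eqP; rewrite -tofrac_eq !tofracM pE divfK.
by rewrite /quotient_rule dpE pE quotient_rule_wd.
Qed.

Lemma frac_der_tofrac p : frac_der (tofrac p) = tofrac (d p).
Proof.
have d1 : d 1 = 0.
  have := dM 1 1; rewrite !mulr1 mul1r -[in LHS](addr0 (d 1)) => /addrI <- //.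
rewrite -[tofrac p]divr1 -tofrac1 frac_derE ?oner_neq0 // /quotient_rule d1.
by rewrite tofrac0 tofrac1 mulr0 subr0 mul1r expr1n divr1.
Qed.

Lemma derivation_frac_der : derivation frac_der.
Proof.
split=> f g; move: (fracE f) (fracE g) (denom_ratioP (repr f)) (denom_ratioP (repr g));
  move: (\n_(repr f)) (\d_(repr f)) (\n_(repr g)) (\d_(repr g)) => a b c e -> -> b0 e0.
  have [b0F e0F] : tofrac b != 0 /\ tofrac e != 0 by rewrite !tofrac_eq0.
  have -> : tofrac a / tofrac b - tofrac c / tofrac e =
      tofrac (a * e - c * b) / tofrac (b * e).
    by rewrite tofracB !tofracM subr_frac.
  rewrite !frac_derE ?mulf_neq0 // /quotient_rule dB !dM.
  by rewrite !(tofracB, tofracD, tofracM) quotient_ruleB.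
have [b0F e0F] : tofrac b != 0 /\ tofrac e != 0 by rewrite !tofrac_eq0.
have -> : tofrac a / tofrac b * (tofrac c / tofrac e) = tofrac (a * c) / tofrac (b * e).
  by rewrite !tofracM mulf_div.
rewrite !frac_derE ?mulf_neq0 // /quotient_rule !dM.
by rewrite !(tofracD, tofracM) quotient_ruleM.
Qed.

End FractionDerivation.

(** * The generic seed, whose [x] and [y] are polynomial variables *)

Section Generic.
Variables n m : nat.
Implicit Types (Q : hypergraph n m) (k : 'I_n).
Local Notation T := {mpoly int[n + n]}.
Local Notation F := {fraction T}.

Definition gen_x (i : 'I_n) : F := tofrac 'X_(lshift n i).
Definition gen_y (i : 'I_n) : F := tofrac 'X_(rshift n i).

Lemma pchar_generic : [pchar F] =i pred0.
Proof.
apply/pcharf0P => e; rewrite -(rmorph_nat (@FracField.tofrac T)) tofrac_eq0.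
by rewrite -(rmorph_nat (@mpolyC (n + n) int)) mpolyC_eq0 pnatr_eq0.
Qed.

Lemma free_generic : free_seed gen_x gen_y.
Proof.
exists (fun a => frac_der (mderiv (unsplit a))); split=> [a|a b].
  by apply: derivation_frac_der => p q; rewrite ?mderivB ?mderivM.
have -> : seed_fam gen_x gen_y b = tofrac 'X_(unsplit b) by case: b.
rewrite frac_der_tofrac => [|p q]; last exact: mderivM.
rewrite mderivX mnm1E -(can_eq (@unsplitK n n)) [unsplit b == _]eq_sym.
case: eqP => [->|_]; last by rewrite scale0r tofrac0.
have -> : (U_(unsplit b) - U_(unsplit b) = 0)%MM.
  by apply/mnmP => i; rewrite mnmBE subnn mnm0E.
by rewrite scale1r mpolyX0 tofrac1.
Qed.

(** The inclusion U(mu_k t) <= U(t); membership at [k] in the old seed is obtained first, since the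
    argument at the other vertices uses it. *)
Lemma star_mut_all (K : fieldType) Q (y x : 'I_n -> K) k :
  [pchar K] =i pred0 -> no_loop Q -> no_2cycle Q -> free_seed x y ->
  forall f, (forall j, star (mutate k Q) (mut_y Q y k) (mut_x Q y x k) j f) ->
  forall j, star Q y x j f.
Proof.
move=> charK noloop no2cycle fxy f all_f j.
have [x0 y0] := free_seed_neq0 fxy.
have Wkf : star Q y x k f by apply: star_mut_same.
have [->//|jk] := eqVneq j k.
apply: (star_mut_diff (k := k)) => //.
exact: exch_regular.
Qed.

Definition laurent (f : F) : Prop :=
  exists (d : 'X_{1..n + n}) (p : T), f * tofrac 'X_[d] = tofrac p.

Lemma laurent_tofrac p : laurent (tofrac p).
Proof. by exists 0%MM, p; rewrite mpolyX0 tofrac1 mulr1. Qed.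

Lemma laurentV d : laurent (tofrac 'X_[d])^-1.
Proof.
exists d, 1; rewrite tofrac1 mulVf // tofrac_eq0.
by rewrite -msupp_eq0 msuppX.
Qed.

Lemma laurentB f g : laurent f -> laurent g -> laurent (f - g).
Proof.
move=> [d [p fE]] [e [q gE]]; exists (d + e)%MM, (p * 'X_[e] - q * 'X_[d]).
by rewrite tofracB mpolyXD !tofracM -fE -gE; ring.
Qed.

Lemma laurentM f g : laurent f -> laurent g -> laurent (f * g).
Proof.
move=> [d [p fE]] [e [q gE]]; exists (d + e)%MM, (p * q).
by rewrite mpolyXD !tofracM -fE -gE; ring.
Qed.

Lemma star_laurent Q k f : star Q gen_y gen_x k f -> laurent f.
Proof.
elim=> {f} [|f g _ Lf _ Lg|f g _ Lf _ Lg|i|i|i|i ik|].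
- by rewrite -tofrac1; apply: laurent_tofrac.
- exact: laurentB.
- exact: laurentM.
- exact: laurent_tofrac.
- exact: laurentV.
- exact: laurent_tofrac.
- exact: laurentV.
apply: laurentM; last exact: laurentV.
have -> : exch Q gen_y gen_x k = tofrac (\prod_(j < n) 'X_(lshift n j) ^+ arr Q k j +
    'X_(rshift n k) * \prod_(i < n) 'X_(lshift n i) ^+ arr Q i k).
  rewrite tofracD tofracM !rmorph_prod /exch; congr (_ + _ * _);
    by apply: eq_bigr => i _; rewrite rmorphXn.
exact: laurent_tofrac.
Qed.

End Generic.

(** * Specialisation of Laurent polynomials *)

Section Specialization.
Variables (n m : nat) (S : comNzRingType).
Local Notation T := {mpoly int[n + n]}.
Local Notation F := {fraction T}.
Variable phi : {rmorphism T -> S}.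
Hypothesis phi_unit : forall i, exists u, phi 'X_i * u = 1.
Implicit Types (f g : F) (s t : S).

(** The graph of the extension of [phi] to Laurent polynomials, as a relation on the whole fraction
    field, where [phi] itself need not extend. *)
Definition spec f s : Prop :=
  exists (d : 'X_{1..n + n}) (p : T),
    f * tofrac 'X_[d] = tofrac p /\ s * phi 'X_[d] = phi p.

Lemma phi_monomial_unit d : exists u, phi 'X_[d] * u = 1.
Proof.
rewrite mpolyXE_id; elim/big_ind: _ => [|p q [u pu] [v qv]|i _].
- by exists 1; rewrite rmorph1 mulr1.
- by exists (u * v); rewrite rmorphM mulrACA pu qv mulr1.
have [u iu] := phi_unit i; exists (u ^+ d i).
by rewrite rmorphXn -exprMn iu expr1n.
Qed.

Lemma spec_eval f s d p : spec f s -> f * tofrac 'X_[d] = tofrac p ->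
  s * phi 'X_[d] = phi p.
Proof.
move=> [e [q [fq sq]]] fp.
have /eqP : tofrac (q * 'X_[d]) = tofrac (p * 'X_[e]).
  by rewrite !tofracM -fq -fp; ring.
rewrite tofrac_eq => /eqP /(congr1 phi); rewrite !rmorphM /= -sq => E.
have [u eu] := phi_monomial_unit e.
by rewrite -[RHS]mulr1 -eu mulrA -E mulrAC -(mulrA s) eu mulr1.
Qed.

Lemma spec_uniq f s t : spec f s -> spec f t -> s = t.
Proof.
move=> fs [d [p [fp tp]]]; have := spec_eval fs fp; rewrite -tp.
have [u du] := phi_monomial_unit d.
by move/(congr1 ( *%R^~ u)); rewrite -!mulrA du !mulr1.
Qed.

Lemma laurent_spec f : laurent f -> exists s, spec f s.
Proof.
move=> [d [p fE]]; have [u du] := phi_monomial_unit d.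
by exists (phi p * u), d, p; rewrite -mulrA (mulrC u) du mulr1.
Qed.

Lemma spec_tofrac p : spec (tofrac p) (phi p).
Proof. by exists 0%MM, p; rewrite mpolyX0 tofrac1 rmorph1 !mulr1. Qed.

Lemma spec1 : spec 1 1.
Proof. by rewrite -tofrac1 -(rmorph1 phi); apply: spec_tofrac. Qed.

Lemma specV i u : phi 'X_i * u = 1 -> spec (tofrac 'X_i)^-1 u.
Proof.
move=> iu; exists U_(i)%MM, 1; rewrite mulVf; last first.
  by rewrite tofrac_eq0 -msupp_eq0 msuppX.
by rewrite tofrac1 rmorph1 mulrC.
Qed.

Lemma specD f g s t : spec f s -> spec g t -> spec (f + g) (s + t).
Proof.
move=> [d [p [fE sE]]] [e [q [gE tE]]].
exists (d + e)%MM, (p * 'X_[e] + q * 'X_[d]).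
by rewrite mpolyXD tofracD !tofracM rmorphD !rmorphM /= -fE -gE -sE -tE; split; ring.
Qed.

Lemma specM f g s t : spec f s -> spec g t -> spec (f * g) (s * t).
Proof.
move=> [d [p [fE sE]]] [e [q [gE tE]]]; exists (d + e)%MM, (p * q).
by rewrite mpolyXD !tofracM !rmorphM /= -fE -gE -sE -tE; split; ring.
Qed.

Lemma specX f s e : spec f s -> spec (f ^+ e) (s ^+ e).
Proof.
by move=> fs; elim: e => [|e IH]; [apply: spec1 | rewrite !exprS; apply: specM].
Qed.

Lemma spec_exch (Q : hypergraph n m) (y x : 'I_n -> F) (t : S) (s : 'I_n -> S) k :
  (forall i, spec (x i) (s i)) -> spec (y k) t ->
  spec (exch Q y x k)
    (\prod_(j < n) s j ^+ arr Q k j + t * \prod_(i < n) s i ^+ arr Q i k).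
Proof.
move=> xs yt; apply: specD; [|apply: specM => //];
  by elim/big_ind2: _ => [|????|i _]; [apply: spec1 | apply: specM | apply: specX].
Qed.

End Specialization.

(** * Even elements of Grassmann algebras *)

Section GrassmannTheory.
Variables (R : comNzRingType) (m : nat).
Local Notation G := (grassmann R m).
Implicit Types (A B C : {set 'I_m}) (f g h : G).

Lemma gr_coefM f g A : gr_coef (f * g) A =
  \sum_(B : {set 'I_m} | B \subset A)
    (-1) ^+ gr_inv B (A :\: B) * (gr_coef f B * gr_coef g (A :\: B)).
Proof. by rewrite /gr_coef ffunE. Qed.

Lemma gr_coef0 A : gr_coef (0 : G) A = 0.
Proof. by rewrite /gr_coef ffunE. Qed.

Lemma gr_coefB f g A : gr_coef (f - g) A = gr_coef f A - gr_coef g A.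
Proof. by rewrite /gr_coef !ffunE. Qed.

Lemma gr_coefD f g A : gr_coef (f + g) A = gr_coef f A + gr_coef g A.
Proof. by rewrite /gr_coef !ffunE. Qed.

Lemma gr_coef_const a A : gr_coef (gr_const a : G) A = a *+ (A == set0).
Proof. by rewrite /gr_coef ffunE. Qed.

Lemma gr_coefMn f k A : gr_coef (f *+ k) A = gr_coef f A *+ k.
Proof.
elim: k => [|k IH]; first by rewrite /gr_coef !mulr0n ffunE.
by rewrite !mulrS gr_coefD IH.
Qed.

Lemma gr_coef1 A : gr_coef (1 : G) A = (A == set0)%:R.
Proof. exact: gr_coef_const. Qed.

Lemma gr_coefP f g : (forall A, gr_coef f A = gr_coef g A) -> f = g.
Proof. by move=> fg; apply/ffunP => A; apply: fg. Qed.

Lemma gr_coef_mul_const f a A : gr_coef (f * gr_const a) A = gr_coef f A * a.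
Proof.
rewrite gr_coefM (bigD1 A) //= big1 => [|B /andP[sBA nBA]].
  by rewrite setDv gr_inv0r mul1r gr_coef_const eqxx addr0.
rewrite gr_coef_const setD_eq0 [A \subset B]negbTE ?mulr0 //.
by apply: contraNN nBA => sAB; rewrite eqEsubset sBA.
Qed.

Lemma gr_const_zmod : zmod_morphism (@gr_const R m).
Proof.
by move=> a b; apply: gr_coefP => A; rewrite gr_coefB !gr_coef_const mulrnBl.
Qed.

Lemma gr_const_monoid : monoid_morphism (@gr_const R m).
Proof.
split=> [//|a b]; apply: gr_coefP => A.
by rewrite gr_coef_mul_const !gr_coef_const mulrnAl.
Qed.

Definition gr_body f : R := gr_coef f set0.

Lemma gr_body_monoid : monoid_morphism gr_body.
Proof.
split=> [|f g]; first by rewrite /gr_body gr_coef1 eqxx.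
rewrite /gr_body gr_coefM (big_pred1 set0) => [|B]; last by rewrite subset0.
by rewrite setD0 gr_inv0l mul1r.
Qed.

Lemma gr_body_zmod : zmod_morphism gr_body.
Proof. by move=> f g; apply: gr_coefB. Qed.

(** Every pair is an inversion in exactly one of the two orders. *)
Lemma gr_inv_swap B C : [disjoint B & C] ->
  (gr_inv B C + gr_inv C B = #|B| * #|C|)%N.
Proof.
move=> dBC; rewrite /gr_inv [X in (_ + X)%N]exchange_big /= -big_split /=.
rewrite -sum1_card big_distrl /=; apply: eq_bigr => b bB.
rewrite mul1n -sum1_card -big_split /=; apply: eq_bigr => c cC.
case: ltngtP => // /val_inj e.
by move/pred0P/(_ c): dBC; rewrite /= cC e bB.
Qed.

Definition gr_even : {pred G} :=
  fun f => [forall A : {set 'I_m}, odd #|A| ==> (gr_coef f A == 0)].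

Lemma gr_evenP f :
  reflect (forall A, odd #|A| -> gr_coef f A = 0) (f \in gr_even).
Proof.
apply: (iffP forallP) => [ef A oA|ef A]; first by have /implyP/(_ oA)/eqP := ef A.
by apply/implyP => oA; rewrite ef.
Qed.

Lemma gr_even_subring : subring_closed gr_even.
Proof.
split=> [|f g /gr_evenP ef /gr_evenP eg|f g /gr_evenP ef /gr_evenP eg];
  apply/gr_evenP => A oA.
- by rewrite gr_coef1; case: eqP oA => // ->; rewrite cards0.
- by rewrite gr_coefB ef // eg // subrr.
rewrite gr_coefM big1 // => B sBA.
move: oA; rewrite -(cardsID B A) (setIidPr sBA) oddD.
by case: (boolP (odd #|B|)) => [/ef ->|_ /= /eg ->]; rewrite ?mul0r !mulr0.
Qed.

(** Exchanging [B] with its complement in [A] changes the sign exponent, modulo 2, by the product of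
    the two cardinals, which is even when [B] has even size. *)
Lemma gr_even_comm f g : f \in gr_even -> g \in gr_even -> f * g = g * f.
Proof.
move=> /gr_evenP ef /gr_evenP eg; apply: gr_coefP => A; rewrite !gr_coefM.
have setDD B : A :\: (A :\: B) = A :&: B by rewrite setDDr setDv set0U.
rewrite [RHS](reindex_onto (fun B => A :\: B) (fun B => A :\: B)) /=; last first.
  by move=> B sBA; rewrite setDD; apply/setIidPr.
have e B : (B \subset A) = (A :\: B \subset A) && (A :\: (A :\: B) == B).
  by rewrite subsetDl setDD; apply/idP/eqP => /setIidPr.
apply: eq_big => // B sBA; rewrite setDD (setIidPr sBA).
case: (boolP (odd #|B|)) => [/ef ->|oB]; first by rewrite mul0r !mulr0.
rewrite [gr_coef g _ * _]mulrC; congr (_ * _).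
have dB : [disjoint B & A :\: B] by rewrite disjoints_subset setCD subsetUr.
have := gr_inv_swap dB => /(congr1 odd); rewrite oddD oddM (negPf oB) /=.
by move=> E; rewrite -[LHS]signr_odd -[RHS]signr_odd; move: E; case: odd; case: odd.
Qed.

End GrassmannTheory.

HB.instance Definition _ (R : comNzRingType) m :=
  GRing.isZmodMorphism.Build R (grassmann R m) gr_const (@gr_const_zmod R m).
HB.instance Definition _ (R : comNzRingType) m :=
  GRing.isMonoidMorphism.Build R (grassmann R m) gr_const (@gr_const_monoid R m).
HB.instance Definition _ (R : comNzRingType) m :=
  GRing.isZmodMorphism.Build (grassmann R m) R (@gr_body R m) (@gr_body_zmod R m).
HB.instance Definition _ (R : comNzRingType) m :=
  GRing.isMonoidMorphism.Build (grassmann R m) R (@gr_body R m) (@gr_body_monoid R m).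
HB.instance Definition _ (R : comNzRingType) m :=
  GRing.isSubringClosed.Build (grassmann R m) (@gr_even R m) (@gr_even_subring R m).

(** The even part is packaged as a commutative ring so that it can be the target of a
    specialisation. *)
Record evengr (R : comNzRingType) m :=
  EvenGr { even_val : grassmann R m; _ : even_val \in @gr_even R m }.

Section EvenRing.
Variables (R : comNzRingType) (m : nat).
HB.instance Definition _ := [isSub for @even_val R m].
HB.instance Definition _ := [Choice of evengr R m by <:].
HB.instance Definition _ := [SubChoice_isSubNzRing of evengr R m by <:].
Fact evengr_mulC : commutative (@GRing.mul (evengr R m)).
Proof.
by move=> f g; apply: val_inj; rewrite !rmorphM /=; apply: gr_even_comm; apply: valP.
Qed.
HB.instance Definition _ := GRing.PzRing_hasCommutativeMul.Build (evengr R m) evengr_mulC.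
End EvenRing.

Section GrassmannField.
Variables (L : fieldType) (m : nat).
Local Notation G := (grassmann L m).

(** The coefficient of a product [f * g] at [A] is the body of [f] times that of [g] at [A], plus
    terms with coefficients of [g] at smaller sets; induction on the size of [A] applies. *)
Lemma gr_mulfI (f : G) : gr_body f != 0 -> injective ( *%R f).
Proof.
move=> f0 g h /eqP; rewrite -subr_eq0 -mulrBr => /eqP fgh.
apply/eqP; rewrite -subr_eq0; apply/eqP; move: {g h} (g - h) fgh => g fg.
apply: gr_coefP => A; rewrite gr_coef0.
have [d] := ubnP #|A|; elim: d A => // d IH A Ad.
have := congr1 (fun f => gr_coef f A) fg; rewrite gr_coef0 gr_coefM.
rewrite (bigD1 set0) ?sub0set //= big1 ?addr0 => [|B /andP[sBA B0]]; last first.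
  rewrite IH ?mulr0 //; apply: leq_trans (proper_card _) Ad.
  have [b bB] := set0Pn _ B0.
  by apply/properP; rewrite subsetDl; split=> //; exists b; rewrite ?(subsetP sBA) // inE bB.
by rewrite gr_inv0l mul1r setD0 => /eqP; rewrite mulf_eq0 (negPf f0) => /eqP.
Qed.

Lemma gr_mulrn_eq0 (f : G) k : [pchar L] =i pred0 -> f *+ k.+1 = 0 -> f = 0.
Proof.
move=> /pcharf0P charL fk; apply: gr_coefP => A.
have := congr1 (fun f => gr_coef f A) fk; rewrite gr_coefMn.
rewrite !gr_coef0 -mulr_natr => /eqP.
by rewrite mulf_eq0 charL orbF => /eqP.
Qed.

Lemma gr_body_xi (i : 'I_m) : gr_body (gr_xi i : G) = 0.
Proof. by rewrite /gr_body /gr_coef ffunE eq_sym -cards_eq0 cards1. Qed.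

Lemma gr_xiM_even (i j : 'I_m) : (gr_xi i * gr_xi j : G) \in @gr_even L m.
Proof.
apply/gr_evenP => A oA; rewrite gr_xiM /gr_coef ffunE.
case: eqVneq => [_|ij]; first by rewrite mulr0.
by case: eqP oA => [->|_]; rewrite ?cards2 ?ij ?mulr0.
Qed.

End GrassmannField.

(** * Odd sums under mutation *)

Section OddSums.
Variables (K : fieldType) (n m : nat).
Implicit Types (Q : hypergraph n m) (k l : 'I_n).
Local Notation G := (superfun K n m).
Hypothesis charK : [pchar K] =i pred0.

Lemma pchar_fraction : [pchar {fraction {mpoly K[n]}}] =i pred0.
Proof.
apply/pcharf0P => e; rewrite -(rmorph_nat (@FracField.tofrac {mpoly K[n]})) tofrac_eq0.
rewrite -(rmorph_nat (@mpolyC n K)) mpolyC_eq0; move/pcharf0P: charK; apply.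
Qed.

(** Arbitrary multiplicities are allowed in order to treat the path counts before cancellation. *)
Definition xi_sum (c : 'I_m -> 'I_m -> nat) : G :=
  \sum_(i < m) \sum_(j < m) (gr_xi i * gr_xi j) *+ c i j.

Lemma eq_xi_sum c c' : (forall i j, c i j = c' i j) -> xi_sum c = xi_sum c'.
Proof. by move=> cc; do 2![apply: eq_bigr => ? _]; rewrite cc. Qed.

Lemma xi_sumD c c' : xi_sum (fun i j => c i j + c' i j)%N = xi_sum c + xi_sum c'.
Proof.
rewrite -big_split; apply: eq_bigr => i _; rewrite -big_split.
by apply: eq_bigr => j _; rewrite mulrnDr.
Qed.

Lemma xi_sumMn c a : xi_sum (fun i j => c i j * a)%N = xi_sum c *+ a.
Proof.
rewrite -sumrMnl; apply: eq_bigr => i _; rewrite -sumrMnl.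
by apply: eq_bigr => j _; rewrite mulrnA.
Qed.

Lemma xi_sum_swap c : xi_sum (fun i j => c j i) = - xi_sum c.
Proof.
rewrite /xi_sum exchange_big -sumrN; apply: eq_bigr => i _ /=; rewrite -sumrN.
by apply: eq_bigr => j _; rewrite gr_xi_anticomm mulNrn.
Qed.

Lemma xi_sum_sym c : (forall i j, c i j = c j i) -> xi_sum c = 0.
Proof.
move=> sym; apply: (gr_mulrn_eq0 (k := 1) pchar_fraction).
by rewrite mulr2n {2}(etrans (eq_xi_sum sym) (xi_sum_swap c)) subrr.
Qed.

(** Cancellation removes the symmetric part [minn (c i j) (c j i)], whose sum vanishes by
    anticommutativity. *)
Lemma xi_sum_cancel c : xi_sum (fun i j => c i j - c j i)%N = xi_sum c.
Proof.
have -> : xi_sum c = xi_sum (fun i j => (c i j - c j i) + minn (c i j) (c j i))%N.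
  by apply: eq_xi_sum => i j; lia.
by rewrite xi_sumD [X in _ + X]xi_sum_sym ?addr0 // => i j; rewrite minnC.
Qed.

Lemma odd_sum_mutate Q k l : no_loop Q ->
  odd_sum K (mutate k Q) l =
  if l == k then - odd_sum K Q k else odd_sum K Q l + odd_sum K Q k *+ arr Q k l.
Proof.
move=> noloop; rewrite -[LHS]/(xi_sum _) /= xi_sum_cancel /reverse_path2 /compose_path2.
case: eqP => [->|_]; last by rewrite xi_sumD xi_sumMn.
rewrite xi_sum_swap; congr (- _); apply: eq_xi_sum => i j.
by rewrite noloop muln0 addn0.
Qed.

Lemma odd_sum_even Q k : odd_sum K Q k \in @gr_even _ m.
Proof. by do 2![apply: rpred_sum => ? _]; rewrite rpredMn // gr_xiM_even. Qed.

Lemma odd_sum_body Q k : gr_body (odd_sum K Q k) = 0.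
Proof.
rewrite rmorph_sum big1 // => i _; rewrite rmorph_sum big1 // => j _.
by rewrite rmorphMn rmorphM /= gr_body_xi mul0r mul0rn.
Qed.

(** Condition (C) factors the sum as [N] times a product of two odd linear forms, which anticommute
    and square to zero. *)
Lemma odd_sum_sqr Q k : condition_C Q -> odd_sum K Q k ^+ 2 = 0.
Proof.
move=> /(_ k) [I [J [N [_ pE]]]].
pose a : G := \sum_(i in I) gr_xi i; pose b : G := \sum_(j in J) gr_xi j.
have -> : odd_sum K Q k = (a * b) *+ N.
  rewrite /a big_distrl -sumrMnl big_mkcond /=; apply: eq_bigr => i _.
  case: ifP => iI; last by rewrite big1 // => j _; rewrite pE iI.
  rewrite /b big_distrr -sumrMnl [RHS]big_mkcond /=; apply: eq_bigr => j _.
  by rewrite pE iI /=; case: ifP.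
have anti (A B : {set 'I_m}) : (\sum_(i in A) gr_xi i) * (\sum_(i in B) gr_xi i) =
    - ((\sum_(i in B) gr_xi i) * (\sum_(i in A) gr_xi i)) :> G.
  rewrite big_distrl [in RHS]big_distrr -sumrN; apply: eq_bigr => i _ /=.
  rewrite big_distrr [in RHS]big_distrl -sumrN; apply: eq_bigr => j _ /=.
  exact: gr_xi_anticomm.
have aa : a * a = 0.
  apply: (gr_mulrn_eq0 (k := 1) pchar_fraction).
  have e : a * a = - (a * a) by exact: anti.
  by rewrite mulr2n {2}e subrr.
have ba : b * a = - (a * b) by exact: anti.
rewrite expr2 mulrnAl mulrnAr mulrA -(mulrA a b a) ba.
by rewrite mulrN mulNr mulrA aa !mul0r oppr0 !mul0rn.
Qed.

End OddSums.

Section UnipotentMutation.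
Variable S : comNzRingType.
Hypothesis torsion2 : forall s : S, s *+ 2 = 0 -> s = 0.

Lemma expr_1D_sqr0 (s : S) a : s ^+ 2 = 0 -> (1 + s) ^+ a = 1 + s *+ a.
Proof.
move=> s2; elim: a => [|a IH]; first by rewrite mulr0n addr0.
by rewrite exprS IH mulrDl mul1r mulrDr mulr1 mulrnAr -expr2 s2 mul0rn addr0
  mulrSr addrA addrAC.
Qed.

(** The square of [s + t *+ a] reduces to twice the cross term, which therefore vanishes. *)
Lemma mul_1D_sqr0 (s t : S) a : s ^+ 2 = 0 -> t ^+ 2 = 0 -> (s + t *+ a) ^+ 2 = 0 ->
  (1 + s) * (1 + t) ^+ a = 1 + (s + t *+ a).
Proof.
move=> s2 t2 st2; rewrite expr_1D_sqr0 //.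
have sta : s * (t *+ a) = 0.
  by apply: torsion2; move: st2; rewrite sqrrD s2 exprMn_n t2 mul0rn addr0 add0r.
by rewrite mulrDl mul1r mulrDr mulr1 sta addr0 -addrA (addrC s).
Qed.

End UnipotentMutation.

(** * Lifting super seeds to generic seeds *)

Lemma mpoly_int_rmorph_eq (N : nat) (S : comNzRingType)
    (f g : {rmorphism {mpoly int[N]} -> S}) :
  (forall i, f 'X_i = g 'X_i) -> f =1 g.
Proof.
move=> fg p; elim/mpolyind: p => [|c e p _ _ IH]; first by rewrite !rmorph0.
rewrite !rmorphD /= IH -mul_mpolyC !rmorphM /= -[c]intz !rmorph_int; congr (_ * _ + _).
rewrite mpolyXE_id !rmorph_prod; apply: eq_bigr => i _.
by rewrite !rmorphXn /= fg.
Qed.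

Section IntegralCoefficients.
Variables (K : fieldType) (n m : nat).
Local Notation G := (superfun K n m).
Implicit Types g h : G.

Definition integral g : Prop := forall A, exists p, gr_coef g A = tofrac p.

Lemma integral1 : integral 1.
Proof.
by move=> A; exists (A == set0)%:R; rewrite gr_coef1 rmorph_nat.
Qed.

Lemma integralB g h : integral g -> integral h -> integral (g - h).
Proof.
move=> ig ih A; have [p gp] := ig A; have [q hq] := ih A.
by exists (p - q); rewrite gr_coefB gp hq tofracB.
Qed.

Lemma integralM g h : integral g -> integral h -> integral (g * h).
Proof.
move=> ig ih A; rewrite gr_coefM.
elim/big_ind: _ => [|a b [p ->] [q ->]|B _]; first by exists 0; rewrite tofrac0.
  by exists (p + q); rewrite tofracD.
have [p ->] := ig B; have [q ->] := ih (A :\: B).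
by exists ((-1) ^+ gr_inv B (A :\: B) * (p * q)); rewrite !rmorphM rmorph_sign.
Qed.

Lemma integral0 : integral 0.
Proof. by rewrite -(subrr 1); apply: integralB; apply: integral1. Qed.

Lemma integralD g h : integral g -> integral h -> integral (g + h).
Proof.
move=> ig ih; rewrite -[h]opprK -[- h]sub0r.
by apply: integralB => //; apply: integralB => //; apply: integral0.
Qed.

Lemma integralX g e : integral g -> integral (g ^+ e).
Proof.
by move=> ig; elim: e => [|e IH]; [apply: integral1 | rewrite exprS; apply: integralM].
Qed.

Lemma integralMn g e : integral g -> integral (g *+ e).
Proof.
by move=> ig; elim: e => [|e IH]; [apply: integral0 | rewrite mulrS; apply: integralD].
Qed.

Lemma integral_int z : integral z%:~R.
Proof.
case: z => e; rewrite ?NegzE ?mulrNz -?[(_ : int)%:~R]pmulrn.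
  exact/integralMn/integral1.
by rewrite -sub0r; apply: integralB; [apply: integral0 | apply/integralMn/integral1].
Qed.

Lemma integral_prod (I : Type) (r : seq I) (E : I -> G) :
  (forall i, integral (E i)) -> integral (\prod_(i <- r) E i).
Proof. by move=> iE; apply: big_ind => //; [apply: integral1 | apply: integralM]. Qed.

Lemma integral_sum (I : Type) (r : seq I) (E : I -> G) :
  (forall i, integral (E i)) -> integral (\sum_(i <- r) E i).
Proof. by move=> iE; apply: big_ind => //; [apply: integral0 | apply: integralD]. Qed.

Lemma integral_xi i : integral (gr_xi i).
Proof.
by move=> A; exists (A == [set i])%:R; rewrite /gr_coef ffunE rmorph_nat.
Qed.

Lemma integral_odd_sum (Q : hypergraph n m) k : integral (odd_sum K Q k).
Proof.
by do 2![apply: integral_sum => ?]; apply/integralMn/integralM; apply: integral_xi.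
Qed.

Lemma integral_superx i : integral (superx K m i).
Proof.
move=> A; rewrite gr_coef_const; exists ('X_i *+ (A == set0)).
by rewrite rmorphMn.
Qed.

End IntegralCoefficients.

(** * Super seeds as specialisations of generic seeds *)

Section SuperSeeds.
Variables (K : fieldType) (n m : nat) (Q0 : hypergraph n m).
Hypothesis charK : [pchar K] =i pred0.
Hypothesis extQ0 : extended_quiver Q0.
Implicit Types (Q : hypergraph n m) (k l : 'I_n).

Local Notation L := {fraction {mpoly K[n]}}.
Local Notation S := (evengr L m).
Local Notation T := {mpoly int[n + n]}.
Local Notation F := {fraction T}.

Lemma superx_even k : superx K m k \in @gr_even L m.
Proof.
by apply/gr_evenP => A oA; rewrite gr_coef_const; case: eqP oA => // ->; rewrite cards0.
Qed.

Definition even_x k : S := EvenGr (superx_even k).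
Definition sigma Q k : S := EvenGr (odd_sum_even K Q k).

Lemma even_torsion2 (s : S) : s *+ 2 = 0 -> s = 0.
Proof.
move=> s2; apply: val_inj; rewrite rmorph0.
apply: (gr_mulrn_eq0 (k := 1) (pchar_fraction n charK)).
by rewrite -[val s *+ 2](rmorphMn (val : S -> _)) s2 rmorph0.
Qed.

Lemma sigma_sqr Q k : condition_C Q -> sigma Q k ^+ 2 = 0.
Proof.
by move=> CQ; apply: val_inj; rewrite rmorphXn rmorph0; apply: odd_sum_sqr.
Qed.

Lemma sigma_mutate Q k l : no_loop Q ->
  sigma (mutate k Q) l = if l == k then - sigma Q k else sigma Q l + sigma Q k *+ arr Q k l.
Proof.
move=> noloop; apply: val_inj; rewrite -[LHS]/(odd_sum K (mutate k Q) l).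
by rewrite odd_sum_mutate //; case: eqP => _; rewrite ?rmorphN ?rmorphD ?rmorphMn.
Qed.

Definition phi_fam (i : 'I_(n + n)) : S :=
  match split i with inl a => even_x a | inr a => 1 + sigma Q0 a end.

Definition phi : {rmorphism T -> S} := mmap intr phi_fam.
(* The cluster variables take positive values at the point [1], so that the
   xi-free parts of the super cluster variables do not vanish. *)
Definition phi1 : {rmorphism T -> int} := mmap intr (fun _ : 'I_(n + n) => 1%Z).

Lemma phi_x a : phi 'X_(lshift n a) = even_x a.
Proof. by rewrite /= mmapX mmap1U /phi_fam (unsplitK (inl a)). Qed.

Lemma phi_y a : phi 'X_(rshift n a) = 1 + sigma Q0 a.
Proof. by rewrite /= mmapX mmap1U /phi_fam (unsplitK (inr a)). Qed.

Lemma phi1X i : phi1 'X_i = 1.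
Proof. by rewrite /= mmapX mmap1U. Qed.

Lemma sigma_unit Q k : condition_C Q -> (1 + sigma Q k) * (1 - sigma Q k) = 1.
Proof. by move=> CQ; rewrite mulrC -subr_sqr expr1n sigma_sqr // subr0. Qed.

Lemma superx_unit a : exists u, even_x a * u = 1.
Proof.
have uE : gr_const (tofrac 'X_a)^-1 \in @gr_even L m.
  by apply/gr_evenP => A oA; rewrite gr_coef_const; case: eqP oA => // ->; rewrite cards0.
exists (EvenGr uE); apply: val_inj; rewrite rmorphM /= -rmorphM divff ?rmorph1 //.
by rewrite tofrac_eq0 -msupp_eq0 msuppX.
Qed.

Lemma phi_unit i : exists u, phi 'X_i * u = 1.
Proof.
rewrite -(splitK i); case: (split i) => a; last first.
  by exists (1 - sigma Q0 a); rewrite phi_y sigma_unit //; case: extQ0.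
by have [u au] := superx_unit a; exists u; rewrite phi_x.
Qed.

Lemma phi1_unit i : exists u, phi1 'X_i * u = 1.
Proof. by exists 1; rewrite phi1X. Qed.

(** The body of [phi p] is the polynomial obtained by setting every [y] to 1; setting every [x] to 1
    as well gives the image of [phi1 p] in [K], nonzero in characteristic 0. *)
Lemma phi_body_neq0 p : phi1 p != 0 -> gr_body (val (phi p)) != 0.
Proof.
pose h (i : 'I_(n + n)) : {mpoly K[n]} := match split i with inl a => 'X_a | inr _ => 1 end.
pose h' : {rmorphism T -> {mpoly K[n]}} := mmap intr h.
have bodyE : gr_body (val (phi p)) = tofrac (h' p).
  apply: (@mpoly_int_rmorph_eq _ _ (@gr_body L m \o val \o phi) (@FracField.tofrac _ \o h')).
  move=> i; rewrite -(splitK i); case: (split i) => a.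
    rewrite -[LHS]/(gr_body (val (phi 'X_(lshift n a)))) phi_x.
    rewrite -[RHS]/(tofrac (h' 'X_(lshift n a))) /h' /= mmapX mmap1U /h (unsplitK (inl a)).
    by rewrite /gr_body gr_coef_const eqxx.
  rewrite -[LHS]/(gr_body (val (phi 'X_(rshift n a)))) phi_y.
  rewrite -[RHS]/(tofrac (h' 'X_(rshift n a))) /h' /= mmapX mmap1U /h (unsplitK (inr a)).
  by rewrite rmorphD /= odd_sum_body rmorph1 addr0 tofrac1.
apply: contra_neq; rewrite bodyE => /eqP; rewrite tofrac_eq0 => /eqP h0.
apply: (intr_pchar0_eq0 charK).
have := congr1 (meval (fun=> 1)) h0; rewrite meval0 => <-.
apply: (@mpoly_int_rmorph_eq _ _ (intr \o phi1) (meval (fun=> 1) \o h')).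
move=> i; rewrite /= !mmapX !mmap1U /h; case: (split i) => a; rewrite ?mevalXU ?rmorph1 //.
Qed.

Lemma integral_phi p : integral (val (phi p)).
Proof.
have -> : phi p = \sum_(e <- msupp p) (p@_e)%:~R * \prod_i phi_fam i ^+ e i by [].
rewrite rmorph_sum; apply: integral_sum => e; rewrite rmorphM rmorph_int.
apply: integralM; first exact: integral_int.
rewrite rmorph_prod; apply: integral_prod => i; rewrite rmorphXn; apply: integralX.
rewrite /phi_fam; case: (split i) => a; first exact: integral_superx.
by rewrite rmorphD rmorph1; apply: integralD; [apply: integral1 | apply: integral_odd_sum].
Qed.

Lemma laurent_phi f s : laurent f -> spec phi f s -> laurent_poly (val s).
Proof.
move=> [d [p fE]] fs; have := spec_eval phi_unit fs fE.
pose dx : 'X_{1..n} := [multinom d (lshift n i) | i < n].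
have CQ0 : condition_C Q0 by case: extQ0.
(* The [y] part of the denominator is inverted by elements with polynomial coefficients, so only a
   monomial in the [x] remains. *)
pose yb : S := \prod_(a < n) (1 - sigma Q0 a) ^+ d (rshift n a).
have -> : phi 'X_[d] = \prod_(a < n) even_x a ^+ d (lshift n a) *
    \prod_(a < n) (1 + sigma Q0 a) ^+ d (rshift n a).
  rewrite mpolyXE_id rmorph_prod big_split_ord /=; congr (_ * _);
  by apply: eq_bigr => a _; rewrite rmorphXn /= ?phi_x ?phi_y.
move=> /(congr1 ( *%R^~ yb)); rewrite -!mulrA -big_split /= [X in _ * (_ * X)]big1 => [|a _];
  last by rewrite -exprMn sigma_unit // expr1n.
rewrite mulr1 => E.
have {}E : val s * val (\prod_(a < n) even_x a ^+ d (lshift n a)) = val (phi p) * val yb.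
  by rewrite -!rmorphM E.
move: E; have -> : val (\prod_(a < n) even_x a ^+ d (lshift n a)) =
    gr_const (tofrac 'X_[dx]) :> superfun K n m.
  rewrite mpolyXE_id !rmorph_prod; apply: eq_bigr => a _.
  by rewrite !rmorphXn /= mnmE.
move=> E; have: integral (val s * gr_const (tofrac 'X_[dx])).
  rewrite E; apply: integralM; first exact: integral_phi.
  rewrite rmorph_prod; apply: integral_prod => a; rewrite rmorphXn; apply: integralX.
  rewrite rmorphB rmorph1; apply: integralB; first exact: integral1.
  exact: integral_odd_sum.
move=> /fin_all_exists [P PE]; exists dx, [ffun A => P A] => A.
rewrite /gr_coef [in RHS]ffunE -PE -/(gr_coef _ A) gr_coef_mul_const mulfK //.
by rewrite tofrac_eq0 -msupp_eq0 msuppX.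
Qed.

Lemma val_exch Q (y : S) (xi : 'I_n -> S) x k : (forall l, val (xi l) = x l) ->
  y = 1 + sigma Q k ->
  val (\prod_(j < n) xi j ^+ arr Q k j + y * \prod_(i < n) xi i ^+ arr Q i k) =
  exchange_rhs Q x k.
Proof.
move=> xiE ->; rewrite rmorphD rmorphM rmorphD rmorph1 !rmorph_prod /exchange_rhs.
by congr (_ + _ * _); apply: eq_bigr => i _; rewrite rmorphXn -xiE.
Qed.

(** The invariant carried along mutations. [lift_star] gives the Laurent property of the generic
    variables and [lift_x1] the cancellability of the super ones; inverses of [Y] have their own
    fields because mutation inverts a coefficient. *)
Record lifted_seed Q (x : 'I_n -> superfun K n m) (X Y : 'I_n -> F) : Prop := LiftedSeed {
  lift_no_loop : no_loop Q;
  lift_no_2cycle : no_2cycle Q;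
  lift_condition_C : condition_C Q;
  lift_free : free_seed X Y;
  lift_star : forall f, (forall k, star Q Y X k f) ->
    forall k, star Q0 (@gen_y n) (@gen_x n) k f;
  lift_y : forall l, spec phi (Y l) (1 + sigma Q l);
  lift_yV : forall l, spec phi (Y l)^-1 (1 - sigma Q l);
  lift_x : forall l, exists2 s, spec phi (X l) s & val s = x l;
  lift_y1 : forall l, spec phi1 (Y l) 1;
  lift_yV1 : forall l, spec phi1 (Y l)^-1 1;
  lift_x1 : forall l, exists2 q, spec phi1 (X l) q & 0 < q
}.

Lemma lifted_laurent Q x X Y l : lifted_seed Q x X Y -> laurent (X l).
Proof.
move=> LS; apply: star_laurent (lift_star LS _ l).
by move=> k; apply: star_x.
Qed.

Lemma lifted_initial : lifted_seed Q0 (superx K m) (@gen_x n) (@gen_y n).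
Proof.
have [noloop no2cycle CQ0] := extQ0.
have y1 := spec_tofrac phi1.
split=> //; [exact: free_generic|..] => l.
- by rewrite -phi_y; apply: spec_tofrac.
- by apply: specV; rewrite phi_y sigma_unit.
- by exists (even_x l) => //; rewrite -phi_x; apply: spec_tofrac.
- by rewrite -(phi1X (rshift n l)); apply: spec_tofrac.
- by apply: specV; rewrite phi1X.
by exists 1 => //; rewrite -(phi1X (lshift n l)); apply: spec_tofrac.
Qed.

(** The numerator of the Laurent polynomial [X l] has a positive value under [phi1], so its image
    under [phi] has nonzero body. *)
Lemma lifted_body_neq0 Q x X Y l : lifted_seed Q x X Y -> gr_body (x l) != 0.
Proof.
move=> LS; have [d [p fE]] := lifted_laurent l LS.
have [s Xs <-] := lift_x LS l; have [q Xq q0] := lift_x1 LS l.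
have := spec_eval phi1_unit Xq fE; have sE := spec_eval phi_unit Xs fE.
have -> : phi1 'X_[d] = 1.
  by rewrite mpolyXE_id rmorph_prod big1 // => i _; rewrite rmorphXn phi1X expr1n.
rewrite mulr1 => qE; have := @phi_body_neq0 p; rewrite -qE gt_eqF // => /(_ isT).
by rewrite -sE rmorphM mulf_eq0 negb_or => /andP[].
Qed.

Lemma lifted_mutate Q x X Y k x'k : lifted_seed Q x X Y ->
  admissible k Q -> x k * x'k = exchange_rhs Q x k ->
  lifted_seed (mutate k Q) (replace k x'k x) (mut_x Q Y X k) (mut_y Q Y k).
Proof.
move=> LS adm ex.
have [noloop no2cycle CQ fXY starQ ys ysV xs y1 yV1 x1] := LS.
have noloop' := no_loop_mutate Q k; have no2cycle' := no_2cycle_mutate Q k.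
have fX'Y' : free_seed (mut_x Q Y X k) (mut_y Q Y k).
  by apply: free_mut_y => //; apply: free_mut_x.
have starQ' f : (forall j, star (mutate k Q) (mut_y Q Y k) (mut_x Q Y X k) j f) ->
    forall j, star Q0 (@gen_y n) (@gen_x n) j f.
  by move=> Wf; apply: starQ; apply: star_mut_all Wf => //; apply: pchar_generic.
have [X0 Y0] := free_seed_neq0 fXY.
have X'k_laurent : laurent (exch Q Y X k / X k).
  have -> : exch Q Y X k / X k = mut_x Q Y X k k by rewrite /mut_x eqxx.
  by apply: star_laurent (starQ' _ _ k) => j; apply: star_x.
(* Admissibility enters here: Condition (C) after mutation makes the new odd sums square to zero. *)
have sig_add l : (sigma Q l + sigma Q k *+ arr Q k l) ^+ 2 = 0.
  have [->|lk] := eqVneq l k; first by rewrite noloop mulr0n addr0 sigma_sqr.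
  by have := sigma_sqr l adm; rewrite sigma_mutate // (negPf lk).
have sig_mul l : (1 + sigma Q l) * (1 + sigma Q k) ^+ arr Q k l =
    1 + (sigma Q l + sigma Q k *+ arr Q k l).
  by apply: mul_1D_sqr0; rewrite ?sigma_sqr //; apply: even_torsion2.
have sig_mulN l : (1 - sigma Q l) * (1 - sigma Q k) ^+ arr Q k l =
    1 - (sigma Q l + sigma Q k *+ arr Q k l).
  rewrite mul_1D_sqr0 ?sqrrN ?sigma_sqr //; first by rewrite mulNrn -opprD.
    exact: even_torsion2.
  by rewrite mulNrn -opprD sqrrN.
split=> // l.
- rewrite sigma_mutate // /mut_y; case: eqP => _; first exact: ysV.
  by rewrite -sig_mul; apply: specM (ys l) (specX _ (ys k)).
- rewrite sigma_mutate // /mut_y; case: eqP => _; first by rewrite invrK opprK.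
  by rewrite -sig_mulN invfM -exprVn; apply: specM (ysV l) (specX _ (ysV k)).
- rewrite /mut_x /replace; case: eqP => _; last exact: xs.
  have [s' Xs'] := laurent_spec phi_unit X'k_laurent.
  (* The specialised variable and [x'k] satisfy the same exchange relation, and [x k] can be
     cancelled since its body is nonzero. *)
  exists s' => //; apply: (gr_mulfI (lifted_body_neq0 k LS)).
  have [xi xiP] := fin_all_exists2 xs => xiE.
  rewrite /= ex -(val_exch xiE (erefl (1 + sigma Q k))) -xiE -rmorphM; congr (val _).
  have := spec_exch Q xiP (ys k).
  have -> : exch Q Y X k = X k * (exch Q Y X k / X k) by rewrite mulrC divfK.
  exact: spec_uniq phi_unit _ _ _ (specM (xiP k) Xs').
- rewrite /mut_y; case: eqP => _; first exact: yV1.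
  by rewrite -[1]mulr1 -{2}(expr1n _ (arr Q k l)); apply: specM (y1 l) (specX _ (y1 k)).
- rewrite /mut_y; case: eqP => _; first by rewrite invrK.
  rewrite invfM -exprVn -[1]mulr1 -{2}(expr1n _ (arr Q k l)).
  by apply: specM (yV1 l) (specX _ (yV1 k)).
rewrite /mut_x; case: eqP => _; last exact: x1.
have [q Xq] := laurent_spec phi1_unit X'k_laurent; exists q => //.
have [r rP r0] := fin_all_exists2 x1.
have := spec_exch Q rP (y1 k).
have -> : exch Q Y X k = X k * (exch Q Y X k / X k) by rewrite mulrC divfK.
move=> /(spec_uniq phi1_unit (specM (rP k) Xq)) E.
(* The specialised exchange relation has positive terms only. *)
have: 0 < r k * q.
  rewrite E mul1r; apply: addr_gt0; apply: prodr_gt0 => i _; exact: exprn_gt0.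
by rewrite pmulr_rgt0.
Qed.

Lemma lifted_seed_exists Q x : mutation_seed Q0 Q x -> exists X Y, lifted_seed Q x X Y.
Proof.
elim=> {Q x} [|Q x k x'k _ [X [Y LS]] adm ex].
  by exists (@gen_x n), (@gen_y n); apply: lifted_initial.
by exists (mut_x Q Y X k), (mut_y Q Y k); apply: lifted_mutate.
Qed.

End SuperSeeds.

Theorem theorem3p2 (K : fieldType) (charK : [pchar K]%R =i pred0)
    (n m : nat) (Q0 : hypergraph n m) (extQ0 : extended_quiver Q0)
    (Q : hypergraph n m) (x : 'I_n -> superfun K n m)
    (seedQx : mutation_seed Q0 Q x) (k : 'I_n) :
  laurent_poly (x k).
Proof.
have [X [Y LS]] := lifted_seed_exists charK extQ0 seedQx.
have [s Xs <-] := lift_x LS k.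
exact: laurent_phi (lifted_laurent k LS) Xs.
Qed.
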